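(* Consider a simple bundle of circles in $\mathbb{R}^3$ with center at the origin (a collection of circles all passing through the origin, distinct circles having distinct tangent lines at the origin), and suppose that the set of tangent lines at the origin of the circles in the bundle contains $54$ generic lines. Then there exists a local diffeomorphism about the origin mapping all the circles of the bundle into straight lines if and only if all the circles in the bundle pass through one common point distinct from the origin.
   Context: A family of curves in $\mathbb{R}^3$ is mapped into straight lines (rectified) by a local diffeomorphism about a point $p$ if there are a neighborhood $U$ of $p$ and a diffeomorphism of $U$ onto its image taking the portion in $U$ of every curve of the family into (a portion of) a straight line. A bundle of curves with center $p$ is any collection of curves passing through $p$; it is simple if distinct curves of the bundle have distinct tangent lines at $p$. $54$ lines passing through the origin of $\mathbb{R}^3$ are called generic if there exists a unique homogeneous cone of degree $9$ containing them all, i.e. if there is, up to multiplication by a nonzero scalar, exactly one nonzero homogeneous polynomial of degree $9$ in three variables vanishing on all $54$ lines. *)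

(* Defs.v *)
From HB Require Import structures.
From mathcomp Require Import all_boot all_order all_algebra.
From mathcomp Require Import all_classical all_reals all_analysis.
From mathcomp Require mpoly.
(* The notations of [mpoly] are incompatible with those of [all_analysis]. *)
Import (canonicals, coercions) mpoly.

Set Implicit Arguments.
Unset Strict Implicit.
Unset Printing Implicit Defensive.

Import Order.TTheory GRing.Theory Num.Theory.
Import numFieldNormedType.Exports.

Local Open Scope classical_set_scope.
Local Open Scope ring_scope.

(* Meaningful for open [U]: the derivatives are those of [f] in the ambient
   space, and only their values on [U] matter. *)
Fixpoint Ck_on (R : realType) (V W : normedModType R) (k : nat)
    (U : set V) (f : V -> W) : Prop :=
  if k is k'.+1 then
    (forall x, U x -> differentiable f x) /\
    (forall v : V, Ck_on k' U (fun x => 'D_v f x))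
  else forall x, U x -> {for x, continuous f}.

Definition smooth_on (R : realType) (V W : normedModType R)
    (U : set V) (f : V -> W) : Prop := forall k, Ck_on k U f.

Definition diffeo_onto_image (R : realType) (V W : normedModType R)
    (U : set V) (f : V -> W) : Prop :=
  [/\ open U, open (f @` U), smooth_on U f &
      exists2 g : W -> V,
        (forall x, U x -> g (f x) = x) & smooth_on (f @` U) g].

Section Space.
Variable R : realType.

(* The norm of ['rV[R]_3] in the library is the sup norm: it defines the usual
   topology and derivatives, but circles need the Euclidean inner product. *)
Local Notation E3 := ('rV[R]_3).

Definition dot (x y : E3) : R := \sum_i x 0 i * y 0 i.

Definition is_line (L : set E3) : Prop :=
  exists a v : E3, v != 0 /\ L = [set a + t *: v | t in [set: R]].

(* The circle with centre [c] and radius [r] in the plane through [c]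
   orthogonal to [n]. *)
Definition is_circle (C : set E3) : Prop :=
  exists (c n : E3) (r : R), [/\ n != 0, 0 < r &
    C = [set x | dot (x - c) n = 0 /\ dot (x - c) (x - c) = r ^+ 2]].

(* All points [p + v] with [v] the velocity at [p] of a parametrized curve
   lying in [C]; this is a line when [C] is a circle through [p]. *)
Definition tangent_line (C : set E3) (p : E3) : set E3 :=
  [set p + v | v in [set v | exists gamma : R -> E3,
     [/\ gamma 0 = p, \forall t \near (0 : R), C (gamma t) &
         is_derive (0 : R) (1 : R) gamma v]]].

Definition rectifies (U : set E3) (f : E3 -> E3) (F : set (set E3)) : Prop :=
  forall C, F C -> exists2 L, is_line L & f @` (C `&` U) `<=` L.

Definition rectifiable_about (p : E3) (F : set (set E3)) : Prop :=
  exists (U : set E3) (f : E3 -> E3),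
    [/\ U p, diffeo_onto_image U f & rectifies U f F].

Definition is_bundle (p : E3) (B : set (set E3)) : Prop :=
  forall C, B C -> C p.

Definition simple_bundle (p : E3) (B : set (set E3)) : Prop :=
  is_bundle p B /\
  forall C D, B C -> B D -> C <> D -> tangent_line C p <> tangent_line D p.

Definition tangent_lines (p : E3) (B : set (set E3)) : set (set E3) :=
  [set tangent_line C p | C in B].

Definition vanishes_on (P : mpoly.mpoly 3 R) (S : set (set E3)) : Prop :=
  forall L x, S L -> L x -> mpoly.meval (fun i => x 0 i) P = 0.

(* Forms, i.e. nonzero homogeneous polynomials, of degree [d]. *)
Definition is_form (d : nat) (P : mpoly.mpoly 3 R) : Prop :=
  P != 0 /\ P \is mpoly.ishomog1 d mpoly.mdeg.

Definition generic54 (S : set (set E3)) : Prop :=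
  [/\ (S #= `I_54)%card,
      (forall L, S L -> is_line L /\ L 0) &
      exists P, [/\ is_form 9 P, vanishes_on P S &
        forall Q, is_form 9 Q -> vanishes_on Q S ->
          exists2 a : R, a != 0 & Q = a *: P]].

End Space.

(* Main.v *)
Require Import Defs.
From mathcomp Require Import all_boot all_order all_algebra.
From mathcomp Require Import all_classical all_reals all_analysis.
From mathcomp Require Import ring lra.
From mathcomp Require complex mpoly.
Import (canonicals, coercions) mpoly complex.
Import Order.TTheory GRing.Theory Num.Theory.
Import numFieldNormedType.Exports.
Set Implicit Arguments.
Unset Strict Implicit.
Unset Printing Implicit Defensive.
Local Open Scope classical_set_scope.
Local Open Scope ring_scope.

(** If all the circles pass through a second point [q], an inversion centred at
    [q] is a diffeomorphism near the origin that maps them into lines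
    ([common_point_rectifiable]).

    Conversely, let a diffeomorphism rectify the bundle. After a translation and
    a linear map it is x + Q x + K x + T x + o(|x|^4) with forms Q, K, T of
    degrees 2, 3, 4 ([diffeo_jet]). A circle through the origin with tangent
    direction v is s |-> (s v + s^2 b) / (1 + be s^2), where b is orthogonal to v
    and be = |b|^2 / |v|^2 ([circle_curve]). Its image lies on the line directed
    by v, so the terms in s^2, s^3 and s^4 are parallel to v ([curve_jet]). The
    term in s^2 gives b = - Q v modulo v, and it remains to see which quadratic
    maps Q are compatible with the two other terms.

    Eliminating b and clearing denominators turns the third and the fourth
    condition into forms of degrees 6 and 7 in v that vanish on the tangent lines
    of the bundle. A form of degree at most 8 vanishing on generic lines is zero
    ([generic54_form_eq0]), hence these forms vanish identically, also at complex
    points. At the points v of the isotropic cone v.v = 0 almost all their terms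
    disappear. The form of degree 6 leaves (v.Q v) (Q v /\ v) = 0, which forces
    v.Q v = 0 there; therefore v.Q v is divisible by v.v, and b is a quadratic
    polynomial in v ([bend_polynomial]). The form of degree 7 leaves
    (b.b) (b /\ v) = 0; as a space of dimension three contains no isotropic
    plane, b /\ v = 0 on the cone, so that b /\ v is v.v times a linear map of v.
    That linear map is orthogonal to v, hence it is the cross product with a
    constant vector p, and b = (v.v) p - (v.p) v ([circle_jet_center]). This says
    that the circle passes through p / (p.p), whatever v is
    ([rectifiable_common_point]). *)

Local Notation homog d := (mpoly.ishomog1 d mpoly.mdeg).

(** * The three coordinates *)

Definition o0 : 'I_3 := @Ordinal 3 0 isT.
Definition o1 : 'I_3 := @Ordinal 3 1 isT.
Definition o2 : 'I_3 := @Ordinal 3 2 isT.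

Lemma I3P (P : 'I_3 -> Prop) : P o0 -> P o1 -> P o2 -> forall i, P i.
Proof.
move=> P0 P1 P2 [[|[|[|//]]] hi].
- by rewrite (_ : Ordinal _ = o0) //; exact: val_inj.
- by rewrite (_ : Ordinal _ = o1) //; exact: val_inj.
- by rewrite (_ : Ordinal _ = o2) //; exact: val_inj.
Qed.

Lemma sum3 (A : nmodType) (F : 'I_3 -> A) : \sum_i F i = F o0 + F o1 + F o2.
Proof.
rewrite !big_ord_recl big_ord0 addr0 addrA.
by congr (_ + _ + _); congr F; exact: val_inj.
Qed.

(** * Scalar products and bivectors *)

Section Dotp.
Variable A : comNzRingType.
Implicit Types u v w b F G : 'I_3 -> A.

Definition dotp u v : A := \sum_i u i * v i.

(** The Pluecker coordinates of a pair of vectors: over a domain, they all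
    vanish exactly when the two vectors are proportional. *)
Definition wedge u v (i j : 'I_3) : A := u i * v j - u j * v i.

Definition comb u (s : A) b : 'I_3 -> A := fun i => u i + s * b i.

Definition scale (a : A) v : 'I_3 -> A := fun i => a * v i.

Lemma dotp3 u v : dotp u v = u o0 * v o0 + u o1 * v o1 + u o2 * v o2.
Proof. exact: sum3. Qed.

Lemma dotpC u v : dotp u v = dotp v u.
Proof. by apply: eq_bigr => i _; rewrite mulrC. Qed.

Lemma dotp0r v : dotp v (fun=> 0) = 0.
Proof. by apply: big1 => i _; rewrite mulr0. Qed.

Lemma dotp_combl u s b v : dotp (comb u s b) v = dotp u v + s * dotp b v.
Proof.
rewrite /dotp mulr_sumr -big_split; apply: eq_bigr => i _.
by rewrite /comb mulrDl mulrA.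
Qed.

Lemma dotp_combr u s b v : dotp v (comb u s b) = dotp v u + s * dotp v b.
Proof. by rewrite dotpC dotp_combl !(dotpC v). Qed.

Lemma dotpB v F G : dotp v (fun i => F i - G i) = dotp v F - dotp v G.
Proof. by rewrite /dotp -sumrB; apply: eq_bigr => i _; rewrite mulrBr. Qed.

Lemma dotpZ v F a : dotp v (fun i => a * F i) = a * dotp v F.
Proof. by rewrite /dotp mulr_sumr; apply: eq_bigr => i _; rewrite mulrCA. Qed.

Lemma dotpZr v F a : dotp v (fun i => F i * a) = dotp v F * a.
Proof. by rewrite mulrC -dotpZ; congr dotp; apply: funext => i; rewrite mulrC. Qed.

Lemma dotp_scale a v F : dotp (scale a v) F = a * dotp v F.
Proof. by rewrite dotpC dotpZ dotpC. Qed.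

Lemma dotp_delta v l : dotp v (fun i => (i == l)%:R) = v l.
Proof.
rewrite /dotp (bigD1 l) //= eqxx mulr1 big1 ?addr0 // => i /negPf ->.
by rewrite mulr0.
Qed.

Lemma wedgeZ u v a i j : wedge (scale a u) v i j = a * wedge u v i j.
Proof. by rewrite /wedge /scale; ring. Qed.

Lemma wedge_collinear u a i j : wedge (scale a u) u i j = 0.
Proof. by rewrite /wedge /scale; ring. Qed.

Lemma wedgev0 u i j : wedge u (fun=> 0) i j = 0.
Proof. by rewrite /wedge !mulr0 subrr. Qed.

Lemma wedge3_eq0 u v : wedge u v o0 o1 = 0 -> wedge u v o0 o2 = 0 ->
  wedge u v o1 o2 = 0 -> forall i j, wedge u v i j = 0.
Proof.
move=> W01 W02 W12.
have Wd i : wedge u v i i = 0 by rewrite /wedge subrr.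
have Ws i j : wedge u v i j = - wedge u v j i by rewrite /wedge opprB.
by apply: I3P; apply: I3P => //; rewrite Ws ?W01 ?W12 ?W02 oppr0.
Qed.

(** Contracting the bivector with [v] recovers the part of [u] that is
    orthogonal to [v], up to the factor [- dotp v v]. *)
Lemma dotp_wedge v u j :
  dotp v (fun i => wedge u v i j) = dotp v u * v j - dotp v v * u j.
Proof.
by rewrite /dotp !mulr_suml -sumrB; apply: eq_bigr => i _; rewrite /wedge; ring.
Qed.

End Dotp.

Lemma wedge_eq0P (R : fieldType) (u v : 'I_3 -> R) : dotp v v != 0 ->
  (forall i j, wedge u v i j = 0) -> forall l, u l = dotp v u / dotp v v * v l.
Proof.
move=> v0 W l; have := dotp_wedge v u l.
rewrite (_ : (fun _ => _) = fun=> 0); last by apply: funext.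
rewrite dotp0r => /esym/eqP; rewrite subr_eq0 => /eqP e.
by rewrite mulrAC e mulrAC mulfV // mul1r.
Qed.

(** * Vector-valued forms of degrees two, three and four *)

Section Forms.
Variables (R A : comNzRingType) (phi : R -> A).
Implicit Types u v w z b : 'I_3 -> A.

(** Forms are given by real tensors, but they are evaluated in an arbitrary
    ring [A] along [phi]: the same expression is read in the reals, in the
    complex numbers, in a polynomial ring in the three coordinates and in a
    polynomial ring in the parameter of a curve. *)
Definition quad (q : 'I_3 -> 'I_3 -> 'I_3 -> R) u v : 'I_3 -> A :=
  fun l => dotp u (fun i => dotp v (fun j => phi (q i j l))).
Definition cub (k : 'I_3 -> 'I_3 -> 'I_3 -> 'I_3 -> R) u v w : 'I_3 -> A :=
  fun l => dotp u (fun i => quad (k i) v w l).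
Definition quart (t : 'I_3 -> 'I_3 -> 'I_3 -> 'I_3 -> 'I_3 -> R) u v w z :
  'I_3 -> A := fun l => dotp u (fun i => cub (t i) v w z l).

Definition cubic (c : 'I_3 -> 'I_3 -> 'I_3 -> R) v : A :=
  dotp v (quad (fun i j l => c l i j) v v).

Definition cub_diff k v b l := cub k b v v l + cub k v b v l + cub k v v b l.

Lemma quad_combl q u t b v l :
  quad q (comb u t b) v l = quad q u v l + t * quad q b v l.
Proof. exact: dotp_combl. Qed.

Lemma quad_combr q u t b v l :
  quad q v (comb u t b) l = quad q v u l + t * quad q v b l.
Proof.
rewrite /quad -dotp_combr; congr dotp; apply: funext => i; exact: dotp_combl.
Qed.

Lemma cub_comb1 k u t b v w l :
  cub k (comb u t b) v w l = cub k u v w l + t * cub k b v w l.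
Proof. exact: dotp_combl. Qed.
Lemma cub_comb2 k u t b v w l :
  cub k v (comb u t b) w l = cub k v u w l + t * cub k v b w l.
Proof.
rewrite /cub -dotp_combr; congr dotp; apply: funext => i; exact: quad_combl.
Qed.
Lemma cub_comb3 k u t b v w l :
  cub k v w (comb u t b) l = cub k v w u l + t * cub k v w b l.
Proof.
rewrite /cub -dotp_combr; congr dotp; apply: funext => i; exact: quad_combr.
Qed.
Lemma quart_comb1 k u t b v w z l :
  quart k (comb u t b) v w z l = quart k u v w z l + t * quart k b v w z l.
Proof. exact: dotp_combl. Qed.
Lemma quart_comb2 k u t b v w z l :
  quart k v (comb u t b) w z l = quart k v u w z l + t * quart k v b w z l.
Proof.
rewrite /quart -dotp_combr; congr dotp; apply: funext => i; exact: cub_comb1.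
Qed.
Lemma quart_comb3 k u t b v w z l :
  quart k v w (comb u t b) z l = quart k v w u z l + t * quart k v w b z l.
Proof.
rewrite /quart -dotp_combr; congr dotp; apply: funext => i; exact: cub_comb2.
Qed.
Lemma quart_comb4 k u t b v w z l :
  quart k v w z (comb u t b) l = quart k v w z u l + t * quart k v w z b l.
Proof.
rewrite /quart -dotp_combr; congr dotp; apply: funext => i; exact: cub_comb3.
Qed.

Lemma quad_scale q a d u v l :
  quad q (scale a u) (scale d v) l = a * d * quad q u v l.
Proof.
rewrite /quad dotp_scale -mulrA; congr (_ * _); rewrite -dotpZ; congr dotp.
by apply: funext => i; rewrite dotp_scale.
Qed.

Lemma cub_scale k a d e u v w l :
  cub k (scale a u) (scale d v) (scale e w) l = a * d * e * cub k u v w l.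
Proof.
rewrite /cub dotp_scale -!mulrA; congr (_ * _); rewrite !mulrA -dotpZ.
by congr dotp; apply: funext => i; rewrite quad_scale.
Qed.

Lemma quart_scale t a d e f u v w z l :
  quart t (scale a u) (scale d v) (scale e w) (scale f z) l =
  a * d * e * f * quart t u v w z l.
Proof.
rewrite /quart dotp_scale -!mulrA; congr (_ * _); rewrite !mulrA -dotpZ.
by congr dotp; apply: funext => i; rewrite cub_scale.
Qed.

(** The third-order condition on a rectified circle, multiplied by [dotp v v]
    and with the vector b eliminated by means of the second-order one. *)
Definition obstruction3 q k v : 'I_3 -> A := fun l =>
  let Q := quad q v v in
  2%:R * dotp v Q * Q l - dotp v v * (quad q v Q l + quad q Q v l)
  + dotp v v * cub k v v v l.

(** The vector b of the rectified circle tangent to [v], once [dotp v (Q v)] is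
    known to be [dotp v v * dotp v m]. *)
Definition bend_field q m v : 'I_3 -> A := fun l =>
  dotp v (fun i => phi (m i)) * v l - quad q v v l.

(** The fourth-order condition multiplied by [dotp v v]. *)
Definition obstruction4 q k t v b : 'I_3 -> A := fun l =>
  dotp v v * (quad q b b l + cub_diff k v b l + quart t v v v v l) + dotp b b * b l.

End Forms.

(** * Evaluation and homogeneity of the forms *)

Section Morph.
Variables (R A A' : comNzRingType) (phi : R -> A) (psi : {rmorphism A -> A'}).

Lemma rmorph_dotp u v : psi (dotp u v) = dotp (psi \o u) (psi \o v).
Proof. by rewrite /dotp rmorph_sum; apply: eq_bigr => i _; rewrite rmorphM. Qed.

Lemma rmorph_quad q u v :
  psi \o quad phi q u v = quad (psi \o phi) q (psi \o u) (psi \o v).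
Proof.
apply: funext => l /=; rewrite /quad rmorph_dotp; congr dotp.
by apply: funext => i /=; rewrite rmorph_dotp.
Qed.

Lemma rmorph_cub k u v w : psi \o cub phi k u v w =
  cub (psi \o phi) k (psi \o u) (psi \o v) (psi \o w).
Proof.
apply: funext => l /=; rewrite /cub rmorph_dotp; congr dotp.
by apply: funext => i /=; rewrite -rmorph_quad.
Qed.

Lemma rmorph_quart t u v w z : psi \o quart phi t u v w z =
  quart (psi \o phi) t (psi \o u) (psi \o v) (psi \o w) (psi \o z).
Proof.
apply: funext => l /=; rewrite /quart rmorph_dotp; congr dotp.
by apply: funext => i /=; rewrite -rmorph_cub.
Qed.

Lemma rmorph_wedge u v i j : psi (wedge u v i j) = wedge (psi \o u) (psi \o v) i j.
Proof. by rewrite /wedge rmorphB !rmorphM. Qed.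

Lemma rmorph_obstruction3 q k v :
  psi \o obstruction3 phi q k v = obstruction3 (psi \o phi) q k (psi \o v).
Proof.
apply: funext => l; rewrite /obstruction3 /= -!rmorph_quad -rmorph_cub -!rmorph_dotp /=.
by rewrite rmorphD rmorphB !rmorphM !rmorphD rmorph1.
Qed.

Lemma rmorph_bend_field q m v :
  psi \o bend_field phi q m v = bend_field (psi \o phi) q m (psi \o v).
Proof.
apply: funext => l; rewrite /bend_field /= -!rmorph_quad /=.
by rewrite rmorphB !rmorphM rmorph_dotp.
Qed.

Lemma rmorph_obstruction4 q k t v b : psi \o obstruction4 phi q k t v b =
  obstruction4 (psi \o phi) q k t (psi \o v) (psi \o b).
Proof.
apply: funext => l; rewrite /obstruction4 /cub_diff /= -!rmorph_quad -!rmorph_cub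
  -!rmorph_quart -!rmorph_dotp /=.
by rewrite !(rmorphD, rmorphM).
Qed.
End Morph.

Section Homog.
Variable R : comNzRingType.
Local Notation M := (mpoly.mpoly 3 R).
Local Notation C := (@mpoly.mpolyC 3 R).
Local Notation X := (fun i : 'I_3 => mpoly.mpolyX R (mpoly.mnm1 i) : M).
Implicit Types u v w : 'I_3 -> M.

Lemma homogC (c : R) : C c \is homog 0.
Proof. by rewrite -mpoly.alg_mpolyC mpoly.dhomogZ // mpoly.dhomog1. Qed.

Lemma homogX i : X i \is homog 1.
Proof. by rewrite mpoly.dhomogX /= (mpoly.mdeg1 i). Qed.

Lemma homog_dotp d e u v : (forall i, u i \is homog d) ->
  (forall i, v i \is homog e) -> dotp u v \is homog (d + e).
Proof.
by move=> hu hv; apply: rpred_sum => i _; apply: mpoly.dhomogM.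
Qed.

Lemma homog_quad d e q u v l : (forall i, u i \is homog d) ->
  (forall i, v i \is homog e) -> quad C q u v l \is homog (d + e).
Proof.
move=> hu hv; apply: homog_dotp => // i; rewrite -[e]addn0.
by apply: homog_dotp => // j; exact: homogC.
Qed.

Lemma homog_cub d e f k u v w l : (forall i, u i \is homog d) ->
  (forall i, v i \is homog e) -> (forall i, w i \is homog f) ->
  cub C k u v w l \is homog (d + (e + f)).
Proof.
by move=> hu hv hw; apply: homog_dotp => // i; apply: homog_quad.
Qed.

Lemma homog_quart d e f g k u v w z l : (forall i, u i \is homog d) ->
  (forall i, v i \is homog e) -> (forall i, w i \is homog f) ->
  (forall i, z i \is homog g) ->
  quart C k u v w z l \is homog (d + (e + (f + g))).
Proof.
by move=> hu hv hw hz; apply: homog_dotp => // i; apply: homog_cub.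
Qed.

Lemma homog_wedge d u i j : (forall i, u i \is homog d) ->
  wedge u X i j \is homog d.+1.
Proof.
by move=> hu; rewrite -[d.+1]addn1 rpredB // mpoly.dhomogM // homogX.
Qed.

Lemma homog_obstruction3 q k l : obstruction3 C q k X l \is homog 5.
Proof.
have hX := homogX; have hQ l' : quad C q X X l' \is homog 2.
  by apply: (homog_quad (d := 1) (e := 1)).
apply: rpredD; first apply: rpredB.
- rewrite -mulrA mulr_natl rpredMn // (mpoly.dhomogM (d := 3)) //.
  exact: (homog_dotp (d := 1) (e := 2)).
- apply: (mpoly.dhomogM (d := 2) (e := 3)); first exact: (homog_dotp (d := 1) (e := 1)).
  apply: rpredD; first by apply: (homog_quad (d := 1) (e := 2)).
  by apply: (homog_quad (d := 2) (e := 1)).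
- apply: (mpoly.dhomogM (d := 2) (e := 3)); first exact: (homog_dotp (d := 1) (e := 1)).
  exact: (homog_cub (d := 1) (e := 1) (f := 1)).
Qed.

Lemma homog_bend_field q m l : bend_field C q m X l \is homog 2.
Proof.
have hX := homogX.
apply: rpredB; last exact: (homog_quad (d := 1) (e := 1)).
apply: (mpoly.dhomogM (d := 1) (e := 1)) => //.
by apply: (homog_dotp (d := 1) (e := 0)) => // i; apply: homogC.
Qed.

Lemma homog_obstruction4 q k t b l : (forall i, b i \is homog 2) ->
  obstruction4 C q k t X b l \is homog 6.
Proof.
have hX := homogX => hb.
apply: rpredD; last first.
  by apply: (mpoly.dhomogM (d := 4) (e := 2)) => //;
    apply: (homog_dotp (d := 2) (e := 2)).
apply: (mpoly.dhomogM (d := 2) (e := 4)); first exact: (homog_dotp (d := 1) (e := 1)).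
apply: rpredD; last exact: (homog_quart (d := 1) (e := 1) (f := 1) (g := 1)).
apply: rpredD; first exact: (homog_quad (d := 2) (e := 2)).
apply: rpredD; last exact: (homog_cub (d := 1) (e := 1) (f := 2)).
apply: rpredD; first exact: (homog_cub (d := 2) (e := 1) (f := 1)).
exact: (homog_cub (d := 1) (e := 2) (f := 1)).
Qed.

End Homog.

Section MEval.
Variables (R : comNzRingType) (A : comNzRingType) (phi : {rmorphism R -> A}).
Local Notation C := (@mpoly.mpolyC 3 R).
Local Notation X := (fun i : 'I_3 => mpoly.mpolyX R (mpoly.mnm1 i)).

Lemma mmap_C (v : 'I_3 -> A) : mpoly.mmap phi v \o C = phi.
Proof. by apply: funext => c /=; rewrite mpoly.mmapC. Qed.
Lemma mmap_X (v : 'I_3 -> A) : mpoly.mmap phi v \o X = v.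
Proof. by apply: funext => i /=; rewrite mpoly.mmapX mpoly.mmap1U. Qed.

Lemma mmap_obstruction3 q k v i j :
  mpoly.mmap phi v (wedge (obstruction3 C q k X) X i j) =
  wedge (obstruction3 phi q k v) v i j.
Proof.
by rewrite rmorph_wedge rmorph_obstruction3 mmap_C mmap_X.
Qed.

Lemma mmap_obstruction4 q k t m v i j : mpoly.mmap phi v
  (wedge (obstruction4 C q k t X (bend_field C q m X)) X i j) =
  wedge (obstruction4 phi q k t v (bend_field phi q m v)) v i j.
Proof.
by rewrite rmorph_wedge rmorph_obstruction4 rmorph_bend_field mmap_C mmap_X.
Qed.
End MEval.

(** * The isotropic cone *)

Section Pointwise.
Variable A : idomainType.
Implicit Types u v b Q : 'I_3 -> A.

(** Otherwise [Q] would be proportional to [v], hence orthogonal to it. *)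
Lemma isotropic_dotp_eq0 v Q : dotp v v = 0 ->
  (forall i j, dotp v Q * wedge Q v i j = 0) -> dotp v Q = 0.
Proof.
move=> v0 H; have [->//|mu0] := eqVneq (dotp v Q) 0.
have W i j : wedge Q v i j = 0.
  by have /eqP := H i j; rewrite mulf_eq0 (negPf mu0) => /eqP.
rewrite /dotp big1 // => i _.
have := dotp_wedge v Q i; rewrite v0 mul0r subr0.
rewrite (_ : (fun _ => _) = fun=> 0); last by apply: funext.
by rewrite dotp0r => /esym/eqP; rewrite mulf_eq0 (negPf mu0) => /eqP ->; rewrite mul0r.
Qed.

(** Lagrange's identity applied to two of the three coordinates: on the isotropic
    vectors the squares of the third coordinates are minus the squared lengths in
    the plane of the two others. *)
Lemma isotropic_wedge_sq v b i j : dotp v v = 0 -> dotp b b = 0 -> dotp v b = 0 ->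
  wedge b v i j ^+ 2 = 0.
Proof.
rewrite !dotp3 => hv hb hvb; move: i j.
have ev : v o2 ^+ 2 = - (v o0 * v o0 + v o1 * v o1) by rewrite -[LHS]subr0 -hv; ring.
have eb : b o2 ^+ 2 = - (b o0 * b o0 + b o1 * b o1) by rewrite -[LHS]subr0 -hb; ring.
have evb : v o2 * b o2 = - (v o0 * b o0 + v o1 * b o1) by rewrite -[LHS]subr0 -hvb;
  ring.
have E01 : wedge b v o0 o1 ^+ 2 = 0.
  transitivity (v o2 ^+ 2 * b o2 ^+ 2 - (v o2 * b o2) ^+ 2); last by ring.
  by rewrite ev eb evb /wedge; ring.
have E02 : wedge b v o0 o2 ^+ 2 = 0.
  transitivity (b o0 ^+ 2 * v o2 ^+ 2 + v o0 ^+ 2 * b o2 ^+ 2 - 2 * b o0 * v o0 *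
    (v o2 * b o2)); first by rewrite /wedge; ring.
  rewrite ev eb evb; transitivity (- wedge b v o0 o1 ^+ 2); first by rewrite /wedge;
    ring.
  by rewrite E01 oppr0.
have E12 : wedge b v o1 o2 ^+ 2 = 0.
  transitivity (b o1 ^+ 2 * v o2 ^+ 2 + v o1 ^+ 2 * b o2 ^+ 2 - 2 * b o1 * v o1 *
    (v o2 * b o2)); first by rewrite /wedge; ring.
  rewrite ev eb evb; transitivity (- wedge b v o0 o1 ^+ 2); first by rewrite /wedge;
    ring.
  by rewrite E01 oppr0.
have Ws k l : wedge b v k l ^+ 2 = wedge b v l k ^+ 2 by rewrite /wedge; ring.
have W0 k : wedge b v k k ^+ 2 = 0 by rewrite /wedge; ring.
by apply: I3P; apply: I3P => //; rewrite Ws.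
Qed.

(** In dimension three an isotropic subspace is at most a line. *)
Lemma isotropic_wedge_eq0 v b : dotp v v = 0 -> dotp v b = 0 ->
  (forall i j, dotp b b * wedge b v i j = 0) -> forall i j, wedge b v i j = 0.
Proof.
move=> hv hvb H i j; have [b0|b0] := eqVneq (dotp b b) 0.
  by have /eqP := isotropic_wedge_sq i j hv b0 hvb; rewrite expf_eq0 => /eqP.
by have /eqP := H i j; rewrite mulf_eq0 (negPf b0) => /eqP.
Qed.
End Pointwise.

(** * Real cubic forms vanishing on the complex isotropic cone *)

Section Cubic.
Variable R : realType.
Local Notation CC := (complex.complex R).
Local Notation toC := (complex.real_complex R : {rmorphism R -> CC}).

(** The form is divisible by the equation of the cone. Every real pair (y, z)
    lifts to the two points (i rho, y, z) and (- i rho, y, z) of the cone with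
    rho^2 = y^2 + z^2. The vanishing of the form there expresses its coefficients
    of degrees 0 and 2 in the first variable through those of degrees 1 and 3. *)
Lemma isotropic_cubic c : (forall v, dotp v v = 0 -> cubic toC c v = 0) ->
  exists m : 'I_3 -> R, forall v, cubic idfun c v = dotp v v * dotp v m.
Proof.
move=> H.
(* The coefficients of x^3, x^2 y and x^2 z. *)
pose m i := if i == o0 then c o0 o0 o0 else c i o0 o0 + c o0 i o0 + c o0 o0 i.
exists m => v.
pose ii : CC := complex.Complex 0 1.
have ii2 : ii * ii = -1 by apply/eqP; rewrite complex.eq_complex /=; apply/andP;
  split; apply/eqP; ring.
set x := v o0; set y := v o1; set z := v o2.
pose rho := Num.sqrt (y ^+ 2 + z ^+ 2).
have rho2 : rho ^+ 2 = y ^+ 2 + z ^+ 2.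
  by rewrite /rho sqr_sqrtr // addr_ge0 // sqr_ge0.
pose w s : 'I_3 -> CC := fun i => if i == o0 then s * ii * toC rho else toC (v i).
have dw s : s ^+ 2 = 1 -> dotp (w s) (w s) = 0.
  move=> s2; rewrite dotp3 /w /= -/y -/z.
  transitivity (s ^+ 2 * (ii * ii) * toC (rho ^+ 2) + toC (y ^+ 2) + toC (z ^+ 2));
    first by rewrite !rmorphXn; ring.
  rewrite ii2 s2 rho2 rmorphD; ring.
pose q2 := c o0 o1 o1 * y * y + c o1 o0 o1 * y * y + c o1 o1 o0 * y * y
 + c o0 o2 o2 * z * z + c o2 o0 o2 * z * z + c o2 o2 o0 * z * z
 + (c o0 o1 o2 + c o0 o2 o1 + c o1 o0 o2 + c o2 o0 o1 + c o1 o2 o0 + c o2 o1 o0) * y *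
   z.
pose c3 := c o1 o1 o1 * y * y * y + (c o1 o1 o2 + c o1 o2 o1 + c o2 o1 o1) * y * y * z
 + (c o1 o2 o2 + c o2 o2 o1 + c o2 o1 o2) * y * z * z + c o2 o2 o2 * z * z * z.
pose L := m o1 * y + m o2 * z.
have gE s : s ^+ 2 = 1 -> cubic toC c (w s) = toC (c3 - rho ^+ 2 * L)
    + s * (ii * toC (rho * (q2 - rho ^+ 2 * c o0 o0 o0))).
  move=> s2.
  have e1 : w s o0 * w s o0 = - toC (rho ^+ 2).
    transitivity (s ^+ 2 * (ii * ii) * toC (rho ^+ 2));
      first by rewrite /w /= !rmorphXn; ring.
    by rewrite s2 ii2; ring.
  transitivity (toC c3 + w s o0 * w s o0 * toC L + w s o0 * toC q2 +
    w s o0 * (w s o0 * w s o0) * toC (c o0 o0 o0)).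
    rewrite /cubic /quad !dotp3 [w s o1]/w [w s o2]/w /= -/y -/z.
    rewrite /c3 /L /q2 /m /= !(rmorphD, rmorphM).
    ring.
  rewrite e1 /w /= !(rmorphB, rmorphM, rmorphXn); ring.
have m1 : (-1 : CC) ^+ 2 = 1 by rewrite sqrrN expr1n.
have h1 := H _ (dw 1 (expr1n _ 2)); have h2 := H _ (dw (-1) m1).
rewrite gE ?expr1n // mul1r in h1.
rewrite gE // mulN1r in h2.
have two0 : (2 : CC) != 0 by rewrite pnatr_eq0.
have a1 : toC (c3 - rho ^+ 2 * L) = 0.
  have : 2 * toC (c3 - rho ^+ 2 * L) = 0 by rewrite -(addr0 0) -{1}h1 -h2; ring.
  by move/eqP; rewrite mulf_eq0 (negPf two0) => /eqP.
have ii0 : ii != 0 by rewrite complex.eq_complex /= oner_eq0 andbF.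
rewrite a1 add0r in h1.
have {h1} : toC (rho * (q2 - rho ^+ 2 * c o0 o0 o0)) = toC 0.
  by move/eqP: h1; rewrite mulf_eq0 (negPf ii0) => /eqP ->; rewrite rmorph0.
move/complex.complexI => a2.
have {a1} : toC (c3 - rho ^+ 2 * L) = toC 0 by rewrite a1 rmorph0.
move/complex.complexI => a1.
have -> : cubic idfun c v = c3 + x * x * L + x * q2 + x * x * x * c o0 o0 o0.
  by rewrite /cubic /quad !dotp3 /= -/x -/y -/z /c3 /L /q2 /m /=; ring.
have -> : dotp v v * dotp v m = (x ^+ 2 + rho ^+ 2) * (x * c o0 o0 o0 + L).
  by rewrite !dotp3 rho2 /= -/x -/y -/z /L {1}/m /=; ring.
have -> : c3 = rho ^+ 2 * L by apply/eqP; rewrite -subr_eq0; apply/eqP.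
have -> : q2 = rho ^+ 2 * c o0 o0 o0.
  have [r0|r0] := eqVneq rho 0; last first.
    by move/eqP: a2; rewrite mulf_eq0 (negPf r0) /= subr_eq0 => /eqP.
  have /eqP : y ^+ 2 + z ^+ 2 = 0 by rewrite -rho2 r0 expr0n.
  rewrite paddr_eq0 ?sqr_ge0 // !sqrf_eq0 => /andP[/eqP y0 /eqP z0].
  by rewrite /q2 y0 z0 r0; ring.
ring.
Qed.
End Cubic.

(** * Forms vanishing on generic lines *)

(** The products of a nonzero form of lower degree with the powers of two
    different coordinates would be two forms of degree 9 that are not
    proportional. *)
Lemma generic54_form_eq0 (R : realType) (S : set (set 'rV[R]_3)) d
    (P : mpoly.mpoly 3 R) : generic54 S -> (d < 9)%N -> P \is homog d ->
  vanishes_on P S -> P = 0.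
Proof.
move=> [_ _ [P9 [_ _ uniq9]]] d9 hP vP; apply/eqP/negPn/negP => P0.
pose n := (9 - d)%N.
pose X i := mpoly.mpolyX R (mpoly.mnm1 i) : mpoly.mpoly 3 R.
have H i : exists2 a : R, a != 0 & P * X i ^+ n = a *: P9.
  apply: uniq9.
    split; first rewrite mulf_neq0 // expf_neq0 //.
      apply/eqP => /(congr1 (mpoly.meval (fun=> 1))) /eqP.
      by rewrite mpoly.mevalXU mpoly.meval0 oner_eq0.
    rewrite -[9%N](subnKC (ltnW d9)) mpoly.dhomogM // -[(9 - d)%N]mul1n.
    exact/mpoly.dhomogMn/homogX.
  by move=> L x SL Lx; rewrite mpoly.mevalM (vP _ _ SL Lx) mul0r.
have [a a0 Ha] := H o0; have [b b0 Hb] := H o1.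
have : P * (b *: X o0 ^+ n - a *: X o1 ^+ n) = 0.
  rewrite mulrBr -!scalerAr Ha Hb !scalerA [b * a]mulrC; exact: subrr.
move/eqP; rewrite mulf_eq0 (negPf P0) /= => /eqP.
move/(congr1 (mpoly.meval (fun i : 'I_3 => if i == o0 then 1 else 0))).
rewrite mpoly.mevalB !mpoly.mevalZ !rmorphXn /= /X !mpoly.mevalXU /= mpoly.meval0.
rewrite expr1n expr0n /n subn_eq0 leqNgt d9 /= mulr0 subr0 mulr1 => /eqP.
by rewrite (negPf b0).
Qed.

(** * The obstructions and the centre of the bundle *)

Lemma dotp_eq0 (R : realType) (v : 'I_3 -> R) : dotp v v = 0 -> v = fun=> 0.
Proof.
rewrite dotp3 -!expr2 => /eqP; rewrite !paddr_eq0 ?addr_ge0 ?sqr_ge0 // !sqrf_eq0.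
by move=> /andP[/andP[/eqP h0 /eqP h1] /eqP h2]; apply: funext; apply: I3P.
Qed.

Lemma dotp_bend_field (R A : comNzRingType) (phi : R -> A) q m v :
  dotp v (bend_field phi q m v) =
  dotp v (phi \o m) * dotp v v - dotp v (quad phi q v v).
Proof.
rewrite /dotp mulr_sumr -sumrB; apply: eq_bigr => i _.
by rewrite /bend_field mulrBr mulrCA.
Qed.

Lemma wedge_bend_field_cubic (R : comNzRingType) q (m : 'I_3 -> R) i j :
  exists c, forall (A : comNzRingType) (phi : {rmorphism R -> A}) v,
    cubic phi c v = wedge (bend_field phi q m v) v i j.
Proof.
(* The tensor of the bend field, then the tensor of the bivector. *)
pose bt i j l := m i * (j == l)%:R - q i j l.
pose c l1 l2 l3 := bt l2 l3 i * (l1 == j)%:R - bt l2 l3 j * (l1 == i)%:R.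
exists c => A phi v.
have btE l : quad phi bt v v l = bend_field phi q m v l.
  transitivity (dotp v (fun i => phi (m i) * v l - dotp v (fun j => phi (q i j l)))).
    congr dotp; apply: funext => i'.
    rewrite -(dotp_delta v l) -dotpZ -dotpB; congr dotp; apply: funext => j'.
    by rewrite /bt rmorphB rmorphM rmorph_nat.
  rewrite dotpB /bend_field; congr (_ - _).
  by rewrite /dotp mulr_suml; apply: eq_bigr => i' _; rewrite mulrA.
rewrite /wedge -!btE [RHS]addrC -mulNr.
transitivity (dotp v (fun l =>
    (l == j)%:R * quad phi bt v v i - (l == i)%:R * quad phi bt v v j)).
  congr dotp; apply: funext => l; rewrite /quad -!dotpZ -dotpB.
  congr dotp; apply: funext => i'; rewrite -!dotpZ -dotpB.
  by congr dotp; apply: funext => j'; rewrite /c rmorphB !rmorphM !rmorph_nat; ring.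
by rewrite dotpB !dotpZr !dotp_delta; ring.
Qed.

(** A linear vector field that is everywhere orthogonal to the position is
    infinitesimally a rotation; [p] is its axis and the right-hand sides are the
    coordinates of the cross product of [p] and [v]. *)
Lemma orthogonal_linear_field (R : realType) (a d e : 'I_3 -> R) :
  (forall v, dotp v v != 0 ->
     v o0 * dotp v a + v o1 * dotp v d + v o2 * dotp v e = 0) ->
  exists p : 'I_3 -> R, forall v,
    [/\ dotp v a = p o1 * v o2 - p o2 * v o1,
        dotp v d = p o2 * v o0 - p o0 * v o2 &
        dotp v e = p o0 * v o1 - p o1 * v o0].
Proof.
move=> H; have skew x y z : x ^+ 2 + y ^+ 2 + z ^+ 2 != 0 ->
    x * (x * a o0 + y * a o1 + z * a o2) + y * (x * d o0 + y * d o1 + z * d o2)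
    + z * (x * e o0 + y * e o1 + z * e o2) = 0.
  pose v i := if i == o0 then x else if i == o1 then y else z.
  have -> : x ^+ 2 + y ^+ 2 + z ^+ 2 = dotp v v by rewrite dotp3 /v /=; ring.
  by move=> /H; rewrite !(dotp3 v).
have s1 := skew 1 0 0; have s2 := skew 0 1 0; have s3 := skew 0 0 1.
have s4 := skew 1 1 0; have s5 := skew 1 0 1; have s6 := skew 0 1 1.
have pos (x : R) : 0 < x -> x != 0 by move=> /lt0r_neq0.
have {s1} a0 : a o0 = 0 by have := s1 (pos _ _); lra.
have {s2} d1 : d o1 = 0 by have := s2 (pos _ _); lra.
have {s3} e2 : e o2 = 0 by have := s3 (pos _ _); lra.
have {s4} a1 : a o1 = - d o0 by have := s4 (pos _ _); lra.
have {s5} e0 : e o0 = - a o2 by have := s5 (pos _ _); lra.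
have {s6} d2 : d o2 = - e o1 by have := s6 (pos _ _); lra.
exists (fun i => if i == o0 then e o1 else if i == o1 then a o2 else d o0) => v.
by rewrite !(dotp3 v) a0 a1 d1 d2 e0 e2 /=; split; ring.
Qed.

Section Obstruction.
Variables (R : realType) (q : 'I_3 -> 'I_3 -> 'I_3 -> R)
  (k : 'I_3 -> 'I_3 -> 'I_3 -> 'I_3 -> R)
  (t : 'I_3 -> 'I_3 -> 'I_3 -> 'I_3 -> 'I_3 -> R).
Implicit Types u v b : 'I_3 -> R.
Local Notation Q v := (quad idfun q v v).
Local Notation CC := (complex.complex R).
Local Notation toC := (complex.real_complex R : {rmorphism R -> CC}).
Local Notation C := (@mpoly.mpolyC 3 R).
Local Notation X := (fun i : 'I_3 => mpoly.mpolyX R (mpoly.mnm1 i)).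

(** The second-order condition only determines [b] modulo [v]; orthogonality
    fixes the component along [v]. *)
Lemma second_orderE v b l : dotp v v != 0 -> dotp v b = 0 ->
  (forall i j, wedge (fun l => b l + Q v l) v i j = 0) ->
  b l = dotp v (Q v) / dotp v v * v l - Q v l.
Proof.
move=> v0 vb W; have := wedge_eq0P v0 W l.
have -> : dotp v (fun l => b l + Q v l) = dotp v (Q v).
  by rewrite -[RHS]add0r -vb /dotp -big_split; apply: eq_bigr => i _; rewrite mulrDr.
by move <-; rewrite addrK.
Qed.

(** With lam = dotp v (Q v) / dotp v v one has Q v + b = lam v, so that the terms
    linear in Q v can be traded for terms linear in b. *)
Lemma obstruction3_vanishes v b : dotp v v != 0 -> dotp v b = 0 ->
  (forall i j, wedge (fun l => b l + Q v l) v i j = 0) ->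
  (forall i j, wedge (fun l => quad idfun q v b l + quad idfun q b v l
    + cub idfun k v v v l) v i j = 0) ->
  forall i j, wedge (obstruction3 idfun q k v) v i j = 0.
Proof.
move=> v0 vb W2 W3 i j; set lam := dotp v (Q v) / dotp v v.
(* Both sides equal lam v. *)
have e : comb (Q v) 1 b = comb v (lam - 1) v.
  apply: funext => l; rewrite /comb (second_orderE l v0 vb W2) -/lam; ring.
have E l : quad idfun q v (Q v) l + quad idfun q (Q v) v l = 2 * lam * Q v l -
   (quad idfun q v b l + quad idfun q b v l).
  have h1 := congr1 (fun w => quad idfun q v w l) e.
  have h2 := congr1 (fun w => quad idfun q w v l) e.
  rewrite !quad_combr in h1; rewrite !quad_combl in h2.
  have -> : quad idfun q v (Q v) l = lam * Q v l - quad idfun q v b l.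
    apply: (addIr (1 * quad idfun q v b l)); rewrite h1; ring.
  have -> : quad idfun q (Q v) v l = lam * Q v l - quad idfun q b v l.
    apply: (addIr (1 * quad idfun q b v l)); rewrite h2; ring.
  ring.
have -> : obstruction3 idfun q k v = (fun l => dotp v v *
  (quad idfun q v b l + quad idfun q b v l + cub idfun k v v v l)).
  apply: funext => l; rewrite /obstruction3 E.
  have -> : dotp v (Q v) = lam * dotp v v by rewrite /lam mulfVK.
  ring.
by rewrite wedgeZ W3 mulr0.
Qed.

(** The conditions that the terms of degrees two, three and four of a map
    x + Q x + K x + T x + o(|x|^4) put on a circle through the origin which that
    map sends into a line. The circle is s |-> (s v + s^2 b) / (1 + be s^2) with
    [b] orthogonal to [v] and be = |b|^2 / |v|^2, so that its image has to be
    parallel to [v]; the third and fourth conditions are the coefficients of s^3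
    and of s^4, the latter cleared of the denominator in be. *)
Definition circle_jet v b := [/\ dotp v b = 0,
  (forall i j, wedge (fun l => b l + Q v l) v i j = 0),
  (forall i j, wedge (fun l => quad idfun q v b l + quad idfun q b v l
    + cub idfun k v v v l) v i j = 0) &
  (forall i j, wedge (obstruction4 idfun q k t v b) v i j = 0)].

Variable good : ('I_3 -> R) -> Prop.
Hypothesis good_generic : forall d (P : mpoly.mpoly 3 R), (d < 9)%N ->
  P \is homog d -> (forall v, good v -> mpoly.meval v P = 0) -> P = 0.
Hypothesis good_jet : forall v, good v -> dotp v v != 0 -> exists b, circle_jet v b.

(** On the isotropic cone the degree six obstruction reduces to its only term
    without the factor [dotp v v], namely [2 * dotp v Q] times the bivector of
    [Q] and [v]. *)
Lemma isotropic_quad (v : 'I_3 -> CC) :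
  dotp v v = 0 -> dotp v (quad toC q v v) = 0.
Proof.
have Z i j : wedge (obstruction3 C q k X) X i j = 0.
  apply: (good_generic (d := 6)) => //.
    by apply: homog_wedge => l; apply: homog_obstruction3.
  move=> w gw; rewrite /mpoly.meval mmap_obstruction3.
  have [w0|w0] := eqVneq (dotp w w) 0; first by rewrite (dotp_eq0 w0) wedgev0.
  have [b [h1 h2 h3 _]] := good_jet gw w0.
  exact: obstruction3_vanishes h1 h2 h3 i j.
move=> v0; apply: isotropic_dotp_eq0 => // i j; apply/eqP.
have : 2%:R * (dotp v (quad toC q v v) * wedge (quad toC q v v) v i j) = 0.
  have := congr1 (mpoly.mmap toC v) (Z i j).
  rewrite mmap_obstruction3 rmorph0 => <-.
  by rewrite /obstruction3 v0 /wedge; ring.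
by move/eqP; rewrite mulf_eq0 pnatr_eq0.
Qed.

(** Since [dotp v (Q v) = dotp v v * dotp v m], the second-order condition
    determines [b] as a quadratic polynomial in [v]. *)
Lemma bend_polynomial : exists m : 'I_3 -> R,
  (forall v, dotp v (Q v) = dotp v v * dotp v m) /\
  (forall v b, dotp v v != 0 -> dotp v b = 0 ->
    (forall i j, wedge (fun l => b l + Q v l) v i j = 0) ->
    b = bend_field idfun q m v).
Proof.
have [m hm] : exists m : 'I_3 -> R, forall v, dotp v (Q v) = dotp v v * dotp v m.
  exact: (@isotropic_cubic R (fun l i j => q i j l)) isotropic_quad.
exists m; split => // v b v0 vb W; apply: funext => l.
rewrite (second_orderE l v0 vb W) hm /bend_field.
by rewrite [dotp v v * _]mulrC mulfK.
Qed.

(** On the isotropic cone the degree seven obstruction reduces to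
    [dotp b b] times the bivector of [b] and [v]. *)
Lemma isotropic_wedge_bend_field m (v : 'I_3 -> CC) i j :
  (forall v b, dotp v v != 0 -> dotp v b = 0 ->
    (forall i j, wedge (fun l => b l + Q v l) v i j = 0) ->
    b = bend_field idfun q m v) ->
  dotp v v = 0 -> wedge (bend_field toC q m v) v i j = 0.
Proof.
move=> bE v0.
have Z i' j' : wedge (obstruction4 C q k t X (bend_field C q m X)) X i' j' = 0.
  apply: (good_generic (d := 7)) => //.
    by apply: homog_wedge => l; apply: homog_obstruction4 => l';
      exact: homog_bend_field.
  move=> w gw; rewrite /mpoly.meval mmap_obstruction4.
  have [w0|w0] := eqVneq (dotp w w) 0; first by rewrite (dotp_eq0 w0) wedgev0.
  have [b [h1 h2 _ h4]] := good_jet gw w0.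
  by rewrite -(bE _ _ w0 h1 h2).
apply: isotropic_wedge_eq0 => // [|i' j'].
  by rewrite dotp_bend_field v0 mulr0 isotropic_quad // subr0.
have := congr1 (mpoly.mmap toC v) (Z i' j').
rewrite mmap_obstruction4 rmorph0 => <-.
by rewrite /obstruction4 v0 /wedge; ring.
Qed.

(** The conclusion says that [b] is the component orthogonal to [v] of a vector
    that does not depend on [v], times [dotp v v]. That vector is the inverse of
    the common point with respect to the unit sphere. *)
Lemma circle_jet_center : exists p : 'I_3 -> R, forall v b, dotp v v != 0 ->
  dotp v b = 0 -> (forall i j, wedge (fun l => b l + Q v l) v i j = 0) ->
  forall l, b l = dotp v v * p l - dotp v p * v l.
Proof.
have [m [hm bE]] := bend_polynomial.
have F i j : exists a, forall v,
    wedge (bend_field idfun q m v) v i j = dotp v v * dotp v a.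
  have [c cE] := wedge_bend_field_cubic q m i j.
  have [|a ha] := @isotropic_cubic R c.
    by move=> v iso; rewrite cE; exact: isotropic_wedge_bend_field.
  by exists a => v; rewrite -ha cE.
have [a ha] := F o1 o2; have [d hd] := F o2 o0; have [e he] := F o0 o1.
have [|p hp] := @orthogonal_linear_field R a d e.
  move=> v v0; apply: (mulfI v0); rewrite mulr0 !mulrDr.
  rewrite mulrCA -ha [X in _ + X + _]mulrCA -hd [X in _ + X]mulrCA -he /wedge.
  by ring.
exists p => v b v0 vb W.
have wE : forall i j, wedge (fun l => b l - dotp v v * p l) v i j = 0.
  have [pa pd pe] := hp v.
  apply: wedge3_eq0; rewrite (bE v b v0 vb W).
  - transitivity (wedge (bend_field idfun q m v) v o0 o1
      - dotp v v * (p o0 * v o1 - p o1 * v o0)); first by rewrite /wedge; ring.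
    by rewrite he pe subrr.
  - transitivity (- (wedge (bend_field idfun q m v) v o2 o0
      - dotp v v * (p o2 * v o0 - p o0 * v o2))); first by rewrite /wedge; ring.
    by rewrite hd pd subrr oppr0.
  - transitivity (wedge (bend_field idfun q m v) v o1 o2
      - dotp v v * (p o1 * v o2 - p o2 * v o1)); first by rewrite /wedge; ring.
    by rewrite ha pa subrr.
move=> l; have := wedge_eq0P v0 wE l.
rewrite dotpB dotpZ vb sub0r mulNr mulrAC mulfV // mul1r mulNr.
by move=> /eqP; rewrite subr_eq => /eqP ->; ring.
Qed.

End Obstruction.

(** * Taylor expansion *)

Lemma normr_coord (R : realType) (m : nat) (x : 'rV[R]_m) i : `|x 0 i| <= `|x|.
Proof.
rewrite [leRHS]/Num.Def.normr /= mx_normrE.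
exact: (le_bigmax _ (fun ij : 'I_1 * 'I_m => `|x ij.1 ij.2|) (0, i)).
Qed.

Lemma normr_row_le (R : realType) (m : nat) (x : 'rV[R]_m) (M : R) : 0 <= M -> (forall
  i, `|x 0 i| <= M) ->
  `|x| <= M.
Proof.
move=> M0 H; rewrite [leLHS]/Num.Def.normr /= mx_normrE; apply: bigmax_le => //.
by move=> [i j] _ /=; rewrite ord1.
Qed.

Section Taylor.
Variables (R : realType) (n m : nat).
Local Notation E := 'rV[R]_n.
Local Notation F := 'rV[R]_m.
Local Notation e i := (delta_mx 0 i : E).

(** The term of degree d of a function is what integration along the rays from
    the origin makes of the terms of degree d - 1 of its partial derivatives. *)
Fixpoint taylor_term (d : nat) (f : E -> F) (x : E) : F :=
  if d is d'.+1 then d%:R^-1 *: \sum_i x 0 i *: taylor_term d' (fun y => 'D_(e i) f y) x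
  else f 0.

Lemma taylor_term_homog d f t x : taylor_term d f (t *: x) = t ^+ d *: taylor_term d f
  x.
Proof.
elim: d f => [|d IH] f /=; first by rewrite expr0 scale1r.
rewrite [RHS]scalerA [t ^+ _ * _]mulrC -scalerA; congr (_ *: _); rewrite scaler_sumr.
by apply: eq_bigr => i _; rewrite IH mxE !scalerA exprS; congr (_ *: _); ring.
Qed.

Lemma derive_sum_coord (f : E -> F) y x : differentiable f y ->
  'D_x f y = \sum_i x 0 i *: 'D_(e i) f y.
Proof.
move=> df; rewrite deriveE // {1}(row_sum_delta x) linear_sum.
by apply: eq_bigr => i _; rewrite linearZ /= deriveE.
Qed.

Lemma is_derive_ray (f : E -> F) (x : E) t l : differentiable f (t *: x) ->
  is_derive t (1 : R) (fun s : R => f (s *: x) 0 l) ('D_x f (t *: x) 0 l).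
Proof.
move=> df.
have dfx : derivable f (t *: x) x by exact: diff_derivable.
have eqq : (fun h : R => h^-1 *: (f ((h *: (1 : R) + t) *: x) - f (t *: x)))
   = (fun h => h^-1 *: (f (h *: x + t *: x) - f (t *: x))).
  by apply: funext => h; rewrite scalerDl [h *: 1]mulr1.
have D : derivable (fun s : R => f (s *: x)) t 1.
  by move: dfx; rewrite /derivable /= eqq.
have De : 'D_1 (fun s : R => f (s *: x)) t = 'D_x f (t *: x).
  by rewrite /derive /= eqq.
apply: DeriveDef; first by move/derivable_mxP: D.
by have := derive_mx D; rewrite De => ->; rewrite mxE.
Qed.

(** By the mean value theorem on the segment from 0 to [x]: the derivative of the
    remainder along the ray is the combination, with coefficients the coordinates
    of [x], of the remainders of the partial derivatives. *)
Lemma taylor_peano k (U : set E) (f : E -> F) : open U -> U 0 -> Ck_on k U f ->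
  forall eps, 0 < eps -> \forall x \near (0 : E),
    `|f x - \sum_(d < k.+1) taylor_term d f x| <= eps * `|x| ^+ k.
Proof.
move=> oU U0; elim: k f => [|k IH] f.
  move=> /= cf eps eps0; have /cvgrPdist_le /(_ _ eps0) := cf _ U0.
  apply: filterS => x; rewrite big_ord1 expr0 mulr1 distrC.
  by [].
move=> [df dCk] eps eps0.
(* There are n partial derivatives; n.+1 avoids a division by 0. *)
pose eps' := eps / n.+1%:R.
have eps'0 : 0 < eps' by rewrite divr_gt0.
have : \forall x \near (0 : E), U x /\ forall i,
   `|'D_(e i) f x - \sum_(d < k.+1) taylor_term d (fun y => 'D_(e i) f y) x| <= eps' *
     `|x| ^+ k.
  apply: filterI; first exact: open_nbhs_nbhs.
  exact: filter_forall (fun i => IH _ (dCk (e i)) _ eps'0).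
move=> /nbhs_ballP[r /= r0 hr]; apply/nbhs_ballP; exists r => //= x xr.
have tx (t : R) : 0 <= t <= 1 -> ball (0 : E) r (t *: x).
  move=> /andP[t0 t1]; move: xr; rewrite -!ball_normE /= !sub0r !normrN normrZ
    ger0_norm //.
  by apply: le_lt_trans; rewrite ler_piMl.
apply: normr_row_le => [|l]; first by rewrite mulr_ge0 ?exprn_ge0 // ltW.
pose p : {poly R} := \poly_(d < k.+2) taylor_term d f x 0 l.
pose h t := f (t *: x) 0 l - p.[t].
pose h' t := 'D_x f (t *: x) 0 l - p^`().[t].
have dh (t : R) : 0 <= t <= 1 -> is_derive t 1 h (h' t).
  move=> /tx/hr[Ut _]; apply: is_deriveB; exact/is_derive_ray/df.
have [c cab hc] : exists2 c, c \in `]0, 1[%R & h 1 - h 0 = h' c * (1 - 0).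
  apply: (@MVT R h h' 0 1 ltr01) => [t tab|]; first by apply: dh;
    rewrite !ltW ?(itvP tab).
  apply: derivable_within_continuous => t; rewrite in_itv /= => tab.
  by apply: ex_derive; apply: dh.
have h0 : h 0 = 0.
  rewrite /h scale0r /p horner_poly big_ord_recl expr0 mulr1 /= big1 ?addr0 ?subrr //
    => i _.
  by rewrite expr0n mulr0.
have h1 : h 1 = (f x - \sum_(d < k.+2) taylor_term d f x) 0 l.
  rewrite /h scale1r /p horner_poly !mxE summxE; congr (_ - _).
  by apply: eq_bigr => i _; rewrite expr1n mulr1.
rewrite -h1 -[h 1]subr0 -h0 hc subr0 mulr1.
have c01 : 0 <= c <= 1 by rewrite !ltW ?(itvP cab).
have [Uc Hc] := hr _ (tx _ c01).
have -> : h' c = (\sum_i x 0 i *: ('D_(e i) f (c *: x) -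
    \sum_(d < k.+1) taylor_term d (fun y => 'D_(e i) f y) (c *: x))) 0 l.
  rewrite /h' derive_sum_coord; last exact: df.
  under [in RHS]eq_bigr do rewrite scalerBr.
  rewrite sumrB !mxE; congr (_ - _).
  rewrite (@horner_coef_wide _ k.+1); last first.
    apply: leq_trans (size_poly _ _) _.
    by have := size_poly k.+2 (fun d => taylor_term d f x 0 l); rewrite -/p;
      case: (size p).
  rewrite summxE.
  under [in RHS]eq_bigr do rewrite mxE summxE mulr_sumr.
  rewrite exchange_big; apply: eq_bigr => d _ /=.
  rewrite coef_deriv coef_poly ltnS ltn_ord /= mxE -mulrnAl -[_^-1 *+ _]mulr_natr
    mulVf ?pnatr_eq0 // mul1r.
  rewrite summxE mulr_suml; apply: eq_bigr => i _.
  by rewrite taylor_term_homog !mxE; ring.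
apply: le_trans (normr_coord _ _) _; apply: le_trans (ler_norm_sum _ _ _) _.
have step i : `|x 0 i *: ('D_(e i) f (c *: x) -
    \sum_(d < k.+1) taylor_term d (fun y => 'D_(e i) f y) (c *: x))| <= `|x| * (eps' *
      `|x| ^+ k).
  rewrite normrZ ler_pM ?normr_ge0 ?normr_coord //.
  apply: le_trans (Hc i) _; rewrite ler_pM2l // lerXn2r ?nnegrE //.
  move/andP: c01 => [c0 c1]; by rewrite normrZ ger0_norm // ler_piMl.
apply: le_trans (ler_sum _ (fun i _ => step i)) _.
rewrite sumr_const card_ord -mulr_natl /eps'.
have -> : n%:R * (`|x| * (eps / n.+1%:R * `|x| ^+ k)) =
  n%:R / n.+1%:R * (eps * `|x| ^+ k.+1) by rewrite exprS; ring.
rewrite ler_piMl // ?mulr_ge0 ?exprn_ge0 ?(ltW eps0) //.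
by rewrite ler_pdivrMr // mul1r ler_nat.
Qed.
End Taylor.

(** * The image of a circle to fourth order *)

Lemma small_poly_coef (R : realType) (n : nat) (h : {poly R}) :
  (forall eps : R, 0 < eps -> exists2 r : R, 0 < r &
     forall s, 0 < `|s| < r -> `|h.[s]| <= eps * `|s| ^+ n) ->
  forall d, (d <= n)%N -> h`_d = 0.
Proof.
elim: n h => [|n IH] h hs.
  move=> d; rewrite leqn0 => /eqP ->; rewrite -horner_coef0.
  apply/eqP; rewrite -normr_le0; apply/ler_addgt0Pr => eps eps0; rewrite add0r.
  have e2 : 0 < eps / 2 by rewrite divr_gt0.
  have [r r0 hr] := hs _ e2.
  have /cvgrPdist_le /(_ _ e2) /nbhs_ballP[r' /= r'0 hr'] := @continuous_horner _ h 0.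
  pose s := Num.min r r' / 2.
  have m0 : 0 < Num.min r r' by rewrite lt_min r0 r'0.
  have s0 : 0 < s by rewrite divr_gt0.
  have sm : s < Num.min r r' by rewrite /s ltr_pdivrMr // mulr_natr mulr2n ltrDl.
  move: sm; rewrite lt_min => /andP[sr sr'].
  have h1 : `|h.[0] - h.[s]| <= eps / 2.
    by apply: hr'; rewrite -ball_normE /= sub0r normrN gtr0_norm.
  have h2 : `|h.[s]| <= eps / 2.
    by have := hr s; rewrite (gtr0_norm s0) s0 sr expr0 mulr1; apply.
  by rewrite -(subrK h.[s] h.[0]) [eps]splitr (le_trans (ler_normD _ _)) // lerD.
have h0 : h`_0 = 0.
  apply: (IH h _ 0%N) => // eps eps0; have [r r0 hr] := hs _ eps0.
  exists (Num.min r 1); first by rewrite lt_min r0 ltr01.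
  move=> s; rewrite lt_min => /andP[s0 /andP[sr s1]].
  apply: le_trans (hr s _) _; first by rewrite s0.
  by rewrite ler_pM2l // exprS ler_piMl ?exprn_ge0 // ltW.
have [g gE] : exists g, h = g * 'X.
  have /factor_theorem[g ->] : root h 0 by rewrite /root horner_coef0 h0.
  by exists g; rewrite subr0.
have gs : forall d, (d <= n)%N -> g`_d = 0.
  apply: IH => eps eps0; have [r r0 hr] := hs _ eps0; exists r => // s /andP[s0 sr].
  have := hr s; rewrite s0 sr gE hornerM hornerX normrM => /(_ isT).
  by rewrite exprSr mulrA ler_pM2r.
by move=> [|d] dn //; rewrite gE coefMX /= gs.
Qed.

Section Expand.
Variables (R A : comNzRingType) (phi : R -> A).
Variables (q : 'I_3 -> 'I_3 -> 'I_3 -> R)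
  (k : 'I_3 -> 'I_3 -> 'I_3 -> 'I_3 -> R)
  (t : 'I_3 -> 'I_3 -> 'I_3 -> 'I_3 -> 'I_3 -> R).
Implicit Types u v b : 'I_3 -> A.

(** The fourth-order jet x + Q x + K x + T x along the curve
    s |-> s (v + s b) / (1 + be s^2), multiplied by the fourth power of the
    denominator. *)
Definition cleared_jet v b (be s : A) : 'I_3 -> A := fun l =>
  let w := comb v s b in let D := 1 + be * s ^+ 2 in
  D ^+ 3 * s * w l + D ^+ 2 * s ^+ 2 * quad phi q w w l
  + D * s ^+ 3 * cub phi k w w w l + s ^+ 4 * quart phi t w w w w l.

Lemma cleared_jet_expand v b be s : exists rho : 'I_3 -> A, forall l,
  cleared_jet v b be s l = s * ((1 + be * s ^+ 2) ^+ 3 * v l)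
   + s ^+ 2 * (b l + quad phi q v v l)
   + s ^+ 3 * (quad phi q v b l + quad phi q b v l + cub phi k v v v l)
   + s ^+ 4 * (be * b l + quad phi q b b l + cub_diff phi k v b l
              + quart phi t v v v v l + 2 * be * (b l + quad phi q v v l))
   + s ^+ 5 * rho l.
Proof.
pose w := comb v s b.
exists (fun l => b l * (3 * be ^+ 2 * s + be ^+ 3 * s ^+ 3)
  + quad phi q v v l * be ^+ 2 * s
  + (quad phi q v b l + quad phi q b v l) * (2 * be + be ^+ 2 * s ^+ 2)
  + quad phi q b b l * (2 * be * s + be ^+ 2 * s ^+ 3)
  + be * cub phi k v v v l + be * s * cub_diff phi k v b l
  + (1 + be * s ^+ 2) * (cub phi k b b v l + cub phi k b v b l + cub phi k v b b l)
  + (1 + be * s ^+ 2) * s * cub phi k b b b l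
  + (quart phi t b w w w l + quart phi t v b w w l + quart phi t v v b w l + quart phi
    t v v v b l)) => l.
rewrite /cleared_jet -/w.
have -> : quart phi t w w w w l = quart phi t v v v v l + s *
   (quart phi t b w w w l + quart phi t v b w w l + quart phi t v v b w l + quart phi
     t v v v b l).
  rewrite {1}/w quart_comb1 -/w.
  have -> : quart phi t v w w w l = quart phi t v v w w l + s * quart phi t v b w w l.
    by rewrite {1}/w quart_comb2.
  have -> : quart phi t v v w w l = quart phi t v v v w l + s * quart phi t v v b w l.
    by rewrite {1}/w quart_comb3.
  have -> : quart phi t v v v w l = quart phi t v v v v l + s * quart phi t v v v b l.
    by rewrite {1}/w quart_comb4.
  ring.
rewrite /w !(quad_combl, quad_combr, cub_comb1, cub_comb2, cub_comb3) /cub_diff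
  {1}/comb.
ring.
Qed.

Definition jet4 v : 'I_3 -> A := fun l =>
  v l + quad phi q v v l + cub phi k v v v l + quart phi t v v v v l.

End Expand.

Section Curve.
Variables (R : realType).
Variables (q : 'I_3 -> 'I_3 -> 'I_3 -> R)
  (k : 'I_3 -> 'I_3 -> 'I_3 -> 'I_3 -> R)
  (t : 'I_3 -> 'I_3 -> 'I_3 -> 'I_3 -> 'I_3 -> R).
Implicit Types u v w b : 'I_3 -> R.

Definition curve v b (be s : R) : 'rV[R]_3 :=
  \row_i (s / (1 + be * s ^+ 2) * comb v s b i).

Lemma jet4_curve v b be s l : 0 <= be ->
  (1 + be * s ^+ 2) ^+ 4 * jet4 idfun q k t (curve v b be s 0) l =
  cleared_jet idfun q k t v b be s l.
Proof.
move=> be0; set D := 1 + be * s ^+ 2.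
have D0 : D != 0 by rewrite gt_eqF // ltr_wpDr // mulr_ge0 // sqr_ge0.
have -> : curve v b be s 0 = scale (s / D) (comb v s b).
  by apply: funext => i; rewrite mxE.
rewrite /jet4 quad_scale cub_scale quart_scale /cleared_jet -/D {1}/scale; field.
exact: D0.
Qed.

Lemma norm_curve v b be s : 0 <= be -> `|s| <= 1 ->
  `|curve v b be s| <= (\sum_i (`|v i| + `|b i|)) * `|s|.
Proof.
move=> be0 s1; apply: normr_row_le => [|i];
  first by rewrite mulr_ge0 // sumr_ge0 // => i _; rewrite addr_ge0.
rewrite mxE normrM mulrC ler_pM //.
  apply: (@le_trans _ _ (`|v i| + `|b i|)).
    apply: le_trans (ler_normD _ _) _; rewrite lerD2l normrM ler_piMl //.
  by rewrite (bigD1 i) //= lerDl sumr_ge0 // => j _; rewrite addr_ge0.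
rewrite normrM ler_piMr // normfV invf_le1; last first.
  by rewrite normr_gt0 gt_eqF // ltr_wpDr // mulr_ge0 // sqr_ge0.
have p : 1 <= 1 + be * s ^+ 2 by rewrite lerDl mulr_ge0 ?sqr_ge0.
by rewrite ger0_norm // (le_trans ler01).
Qed.

Lemma horner_cleared_jet v b be s u i j :
  (wedge (cleared_jet (@polyC R) q k t (polyC \o v) (polyC \o b) be%:P 'X)
    (polyC \o u) i j).[s]
  = wedge (cleared_jet idfun q k t v b be s) u i j.
Proof.
pose ev : {rmorphism {poly R} -> R} := horner_eval s.
have evC : ev \o (@polyC R) = idfun by apply: funext => c /=;
  rewrite /horner_eval hornerC.
have evCv (w : 'I_3 -> R) : ev \o (polyC \o w) = w.
  by apply: funext => c /=; rewrite /horner_eval hornerC.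
have evX : ev 'X = s by rewrite /= /horner_eval hornerX.
have evw : ev \o comb (polyC \o v) 'X (polyC \o b) = comb v s b.
  by apply: funext => l /=; rewrite /horner_eval /comb hornerD hornerM !hornerC hornerX.
rewrite -[LHS]/(ev _) rmorph_wedge evCv; congr (wedge _ u i j).
apply: funext => l; rewrite /cleared_jet /=; rewrite -[LHS]/(ev _).
rewrite !(rmorphD, rmorphM, rmorphXn, rmorph1) evX.
have -> : ev be%:P = be by rewrite /= /horner_eval hornerC.
have eC (w1 : 'I_3 -> {poly R}) : ev (quad polyC q w1 w1 l) = quad idfun q (ev \o w1)
  (ev \o w1) l.
  by rewrite -evC -rmorph_quad.
have eC3 (w1 : 'I_3 -> {poly R}) : ev (cub polyC k w1 w1 w1 l) = cub idfun k (ev \o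
  w1) (ev \o w1) (ev \o w1) l.
  by rewrite -evC -rmorph_cub.
have eC4 (w1 : 'I_3 -> {poly R}) : ev (quart polyC t w1 w1 w1 w1 l) = quart idfun t
  (ev \o w1) (ev \o w1) (ev \o w1) (ev \o w1) l.
  by rewrite -evC -rmorph_quart.
by rewrite eC eC3 eC4 evw /= /horner_eval !hornerC.
Qed.

Variable G : 'rV[R]_3 -> 'rV[R]_3.
Hypothesis G_jet : forall eps, 0 < eps -> \forall x \near (0 : 'rV[R]_3),
  forall l, `|G x 0 l - jet4 idfun q k t (x 0) l| <= eps * `|x| ^+ 4.

(** The jet differs from the map by o(|x|^4), and |curve| = O(|s|): along the
    curve, the bivector of the jet with [u] is a polynomial in [s], up to the
    denominator, and it is o(|s|^4). *)
Lemma curve_poly_coef v b be u : 0 <= be ->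
  (\forall x \near (0 : 'rV[R]_3), forall s, x = curve v b be s ->
     forall i j, wedge (G x 0) u i j = 0) ->
  forall i j d, (d <= 4)%N ->
  (wedge (cleared_jet (@polyC R) q k t (polyC \o v) (polyC \o b) be%:P 'X)
    (polyC \o u) i j)`_d = 0.
Proof.
move=> be0 H i j; apply: small_poly_coef => eps eps0.
pose C := \sum_i (`|v i| + `|b i|) + 1.
have C0 : 0 < C by rewrite ltr_wpDl // sumr_ge0 // => l _; rewrite addr_ge0.
pose M := `|u i| + `|u j| + 1.
have M0 : 0 < M by rewrite ltr_wpDl // addr_ge0.
(* The bounds, for |s| <= 1, of the denominator, of |curve| / |s| and of [u]. *)
pose K := (1 + be) ^+ 4 * C ^+ 4 * M.
have K0 : 0 < K by rewrite mulr_gt0 // mulr_gt0 // exprn_gt0 // ltr_wpDr.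
have e0 : 0 < eps / K by rewrite divr_gt0.
have FI : \forall x \near (0 : 'rV[R]_3),
    (forall l, `|G x 0 l - jet4 idfun q k t (x 0) l| <= eps / K * `|x| ^+ 4) /\
    (forall s, x = curve v b be s -> forall i j, wedge (G x 0) u i j = 0).
  exact: filterI (G_jet e0) H.
move: FI => /nbhs_ballP[r /= r0 hr].
exists (Num.min 1 (r / C)); first by rewrite lt_min ltr01 divr_gt0.
move=> s; rewrite lt_min => /andP[s0 /andP[s1 sr]].
have nc := norm_curve v b be0 (ltW s1).
have nc' : `|curve v b be s| <= C * `|s|.
  by apply: le_trans nc _; rewrite ler_pM2r // lerDl.
have inb : ball (0 : 'rV[R]_3) r (curve v b be s).
  rewrite -ball_normE /= sub0r normrN; apply: le_lt_trans nc' _.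
  by rewrite mulrC -ltr_pdivlMr.
have [h1 h2] := hr _ inb; have {}h2 := h2 _ erefl i j.
rewrite horner_cleared_jet.
set D := 1 + be * s ^+ 2.
have D1 : 0 <= D <= 1 + be.
  have s2 : 0 <= s ^+ 2 <= 1.
    by rewrite sqr_ge0 -real_normK ?num_real // exprn_ile1 // ltW.
  move/andP: s2 => [s20 s21].
  apply/andP; split; rewrite /D; first by apply: addr_ge0 => //; apply: mulr_ge0.
  by rewrite lerD2l ler_piMr.
have -> : wedge (cleared_jet idfun q k t v b be s) u i j =
   D ^+ 4 * (wedge (fun l => jet4 idfun q k t (curve v b be s 0) l - G (curve v b be
     s) 0 l) u i j).
  transitivity (D ^+ 4 * (wedge (jet4 idfun q k t (curve v b be s 0)) u i j)).
    by rewrite -wedgeZ; congr (wedge _ u i j); apply: funext => l; rewrite -jet4_curve.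
  congr (_ * _); rewrite -[RHS]addr0 -h2 /wedge; ring.
have -> : eps * `|s| ^+ 4 = (1 + be) ^+ 4 * (eps / K * (C * `|s|) ^+ 4 * M).
  rewrite /K; field; rewrite !gt_eqF // ltr_wpDr //.
move/andP: D1 => [D0 D1].
rewrite normrM normrX (ger0_norm D0); apply: ler_pM => //.
- exact: exprn_ge0.
- by rewrite lerXn2r // nnegrE ?(le_trans D0).
have h1' l : `|jet4 idfun q k t (curve v b be s 0) l - G (curve v b be s) 0 l| <= eps
  / K * (C * `|s|) ^+ 4.
  rewrite distrC; apply: le_trans (h1 l) _; rewrite ler_pM2l // lerXn2r ?nnegrE //.
  by rewrite mulr_ge0 // ltW.
rewrite /wedge; apply: le_trans (ler_normB _ _) _; rewrite !normrM.
apply: (@le_trans _ _ (eps / K * (C * `|s|) ^+ 4 * `|u j| + eps / K * (C * `|s|) ^+ 4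
  * `|u i|)).
  by apply: lerD; apply: ler_wpM2r.
rewrite -mulrDr; apply: ler_wpM2l; first by apply: mulr_ge0;
  [exact: ltW|apply/exprn_ge0/mulr_ge0 => //; exact: ltW].
by rewrite /M addrC lerDl.
Qed.

(** The coefficient of [s] shows that the direction [w] of the line is that of
    [v]; the bivector with [v] then has no terms of degrees 2, 3 and 4. *)
Lemma curve_jet v b be w : 0 <= be -> dotp v v != 0 -> dotp v b = 0 ->
  be * dotp v v = dotp b b -> (exists l, w l != 0) ->
  (\forall x \near (0 : 'rV[R]_3), forall s, x = curve v b be s ->
     forall i j, wedge (G x 0) w i j = 0) ->
  circle_jet q k t v b.
Proof.
move=> be0 v0 vb beE w0 Hw.
have [rho hrho] := cleared_jet_expand (@polyC R) q k t (polyC \o v) (polyC \o b) be%:P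
  'X.
have CQ x y l : quad polyC q (polyC \o x) (polyC \o y) l = (quad idfun q x y l)%:P.
  by rewrite -[polyC]/(polyC \o idfun) -rmorph_quad.
have CK x y z l : cub polyC k (polyC \o x) (polyC \o y) (polyC \o z) l = (cub idfun k
  x y z l)%:P.
  by rewrite -[polyC]/(polyC \o idfun) -rmorph_cub.
have CT l : quart polyC t (polyC \o v) (polyC \o v) (polyC \o v) (polyC \o v) l
   = (quart idfun t v v v v l)%:P.
  by rewrite -[polyC]/(polyC \o idfun) -rmorph_quart.
pose B2 l := b l + quad idfun q v v l.
pose B3 l := quad idfun q v b l + quad idfun q b v l + cub idfun k v v v l.
pose B4 l := be * b l + quad idfun q b b l + cub_diff idfun k v b l
              + quart idfun t v v v v l + 2 * be * B2 l.
have {}hrho l : cleared_jet (@polyC R) q k t (polyC \o v) (polyC \o b) be%:P 'X l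
   = 'X * ((1 + be%:P * 'X ^+ 2) ^+ 3 * (v l)%:P) +
     'X ^+ 2 * ((B2 l)%:P + 'X * (B3 l)%:P + 'X ^+ 2 * (B4 l)%:P + 'X ^+ 3 * rho l).
  rewrite hrho /cub_diff !CQ !CK CT /B4 /B3 /B2 /cub_diff /= !(polyCD, polyCM).
  rewrite ?polyC1; ring.
have vw i j : wedge v w i j = 0.
  have := curve_poly_coef be0 Hw i j (isT : (1 <= 4)%N).
  pose B l := (B2 l)%:P + 'X * (B3 l)%:P + 'X ^+ 2 * (B4 l)%:P + 'X ^+ 3 * rho l.
  have -> : wedge (cleared_jet (@polyC R) q k t (polyC \o v) (polyC \o b) be%:P 'X)
    (polyC \o w) i j
   = 'X * ((wedge v w i j)%:P + 'X * (wedge B (polyC \o w) i j +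
      (3 * be%:P * 'X + 3 * be%:P ^+ 2 * 'X ^+ 3 + be%:P ^+ 3 * 'X ^+ 5) * (wedge v w
        i j)%:P)).
    rewrite /wedge !hrho /B /= !(polyCB, polyCM); ring.
  by rewrite !(coefXM, coefD, coefC) /= addr0.
have wE l : w l = dotp v w / dotp v v * v l.
  by apply: wedge_eq0P => // i j; rewrite /wedge -[RHS]oppr0 -(vw i j) /wedge; ring.
have c0 : dotp v w / dotp v v != 0.
  by have [l wl] := w0; apply: contraNneq wl => c0; rewrite wE c0 mul0r.
have Hv : \forall x \near (0 : 'rV[R]_3), forall s, x = curve v b be s ->
     forall i j, wedge (G x 0) v i j = 0.
  apply: filterS Hw => x + s xs i j => /(_ s xs i j) e; apply: (mulfI c0).
  by rewrite mulr0 -e /wedge !wE; ring.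
have hE i j : wedge (cleared_jet (@polyC R) q k t (polyC \o v) (polyC \o b) be%:P 'X)
  (polyC \o v) i j
   = 'X * ('X * ((wedge B2 v i j)%:P + 'X * ((wedge B3 v i j)%:P + 'X * ((wedge B4 v i
     j)%:P +
      'X * wedge rho (polyC \o v) i j)))).
  rewrite /wedge !hrho /= !(polyCB, polyCM); ring.
have H i j d : (d <= 4)%N -> _ := @curve_poly_coef v b be v be0 Hv i j d.
have W2 i j : wedge B2 v i j = 0.
  by have := H i j 2%N isT; rewrite hE !(coefXM, coefD, coefC) /= addr0.
have W3 i j : wedge B3 v i j = 0.
  by have := H i j 3%N isT; rewrite hE !(coefXM, coefD, coefC) /= addr0 add0r.
have W4 i j : wedge B4 v i j = 0.
  by have := H i j 4%N isT; rewrite hE !(coefXM, coefD, coefC) /= addr0 !add0r.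
split => // i j.
transitivity (dotp v v * (wedge B4 v i j - 2 * be * wedge B2 v i j)).
  by rewrite /obstruction4 -beE /wedge /B4; ring.
by rewrite W4 W2 mulr0 subr0 mulr0.
Qed.
End Curve.

(** * The normalized jet of a diffeomorphism *)

Section Jet.
Variable R : realType.
Local Notation E3 := 'rV[R]_3.
Local Notation e i := (delta_mx 0 i : E3).

Lemma mulmx_coord_le (r : E3) (M : 'M[R]_3) l :
  `|(r *m M) 0 l| <= `|r| * \sum_i \sum_j `|M i j|.
Proof.
rewrite mxE; apply: le_trans (ler_norm_sum _ _ _) _; rewrite mulr_sumr.
apply: ler_sum => i _; rewrite normrM ler_pM ?normr_coord //.
by rewrite (bigD1 l) //= lerDl sumr_ge0.
Qed.

Definition jacobi (f : E3 -> E3) : 'M[R]_3 := \matrix_i 'D_(e i) f 0.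

Lemma derive_jacobi f (x : E3) : differentiable f 0 -> 'D_x f 0 = x *m jacobi f.
Proof.
move=> df; rewrite derive_sum_coord // mulmx_sum_row; apply: eq_bigr => i _.
by rewrite rowK.
Qed.

(** The chain rule for the inverse: a vector killed by the differential of [f] at
    the origin is its own image under the differential of the identity. *)
Lemma diffeo_jacobi_unit (U : set E3) (f : E3 -> E3) : U 0 -> diffeo_onto_image U f ->
  jacobi f \in unitmx.
Proof.
move=> U0 [oU oV sf [g gf sg]].
have df : differentiable f 0 by have [h _] := sf 1%N; exact: h.
have dg : differentiable g (f 0).
  by have [h _] := sg 1%N; apply: h; exists 0.
rewrite -row_free_unit -kermx_eq0; apply/rowV0P => x /sub_kermxP xA.
have : 'D_x (g \o f) 0 = x.
  rewrite (@near_eq_derive _ _ _ (g \o f) id) ?derive_id //.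
  have : \forall y \near (0 : E3), U y by exact: open_nbhs_nbhs.
  by apply: filterS => y Uy /=; rewrite gf.
rewrite deriveE; last exact: differentiable_comp.
by rewrite diff_comp //= -[X in 'd g _ X]deriveE // derive_jacobi // xA linear0.
Qed.

Lemma taylor_termS_mul d f (x : E3) (M : 'M[R]_3) l : (taylor_term d.+1 f x *m M) 0 l =
  dotp (x 0) (fun i => d.+1%:R^-1 * (taylor_term d (fun y => 'D_(e i) f y) x *m M) 0 l).
Proof.
rewrite dotpZ /= -scalemxAl mxE mulmx_suml summxE; congr (_ * _).
by apply: eq_bigr => i _; rewrite -scalemxAl mxE.
Qed.

Definition pderiv i (f : E3 -> E3) : E3 -> E3 := fun y => 'D_(e i) f y.

(** The tensors of the Taylor terms after the linear map [M]; the scalars are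
    those of the recursion that defines these terms. *)
Definition coef2 f (M : 'M[R]_3) i j l : R :=
  2^-1 * (1^-1 * (pderiv j (pderiv i f) 0 *m M) 0 l).
Definition coef3 f M i j m l : R := 3^-1 * coef2 (pderiv i f) M j m l.
Definition coef4 f M i j m h l : R := 4^-1 * coef3 (pderiv i f) M j m h l.

Lemma taylor_term2_mul f x M l :
  (taylor_term 2 f x *m M) 0 l = quad idfun (coef2 f M) (x 0) (x 0) l.
Proof.
rewrite taylor_termS_mul /quad; congr dotp; apply: funext => i.
by rewrite taylor_termS_mul -dotpZ.
Qed.

Lemma taylor_term3_mul f x M l :
  (taylor_term 3 f x *m M) 0 l = cub idfun (coef3 f M) (x 0) (x 0) (x 0) l.
Proof.
rewrite taylor_termS_mul /cub; congr dotp; apply: funext => i;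
  rewrite taylor_term2_mul /quad -dotpZ.
by congr dotp; apply: funext => j; rewrite -dotpZ.
Qed.

Lemma taylor_term4_mul f x M l :
  (taylor_term 4 f x *m M) 0 l = quart idfun (coef4 f M) (x 0) (x 0) (x 0) (x 0) l.
Proof.
rewrite taylor_termS_mul /quart; congr dotp; apply: funext => i;
  rewrite taylor_term3_mul /cub -dotpZ.
congr dotp; apply: funext => j; rewrite /quad -dotpZ.
by congr dotp; apply: funext => m; rewrite -dotpZ.
Qed.

Lemma sum5 (V : nmodType) (F : nat -> V) :
  \sum_(d < 5) F d = F 0%N + (F 1%N + (F 2%N + (F 3%N + F 4%N))).
Proof. by rewrite !big_ord_recl big_ord0 addr0. Qed.

Lemma diffeo_jet (U : set E3) (f : E3 -> E3) : U 0 -> diffeo_onto_image U f ->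
  exists (M : 'M[R]_3) q k t, M \in unitmx /\ forall eps, 0 < eps ->
    \forall x \near (0 : E3), forall l,
      `|((f x - f 0) *m M) 0 l - jet4 idfun q k t (x 0) l| <= eps * `|x| ^+ 4.
Proof.
move=> U0 dif; have uA := diffeo_jacobi_unit U0 dif.
have [oU _ sf _] := dif; have T4 := taylor_peano oU U0 (sf 4%N).
pose M := invmx (jacobi f).
exists M, (coef2 f M), (coef3 f M), (coef4 f M).
split; first by rewrite unitmx_inv.
move=> eps eps0; pose K := \sum_i \sum_j `|M i j| + 1.
have K0 : 0 < K by rewrite ltr_wpDl // sumr_ge0 // => i _; rewrite sumr_ge0.
have := T4 _ (divr_gt0 eps0 K0); apply: filterS => x hx l.
have e1 : (taylor_term 1 f x *m M) 0 l = x 0 l.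
  have -> : taylor_term 1 f x = x *m jacobi f.
    by rewrite mulmx_sum_row /= invr1 scale1r; apply: eq_bigr => i _; rewrite rowK.
  by rewrite mulmxK.
have -> : ((f x - f 0) *m M) 0 l - jet4 idfun (coef2 f M) (coef3 f M) (coef4 f M) (x
  0) l =
   ((f x - \sum_(d < 5) taylor_term d f x) *m M) 0 l; last first.
  apply: le_trans (mulmx_coord_le _ _ _) _.
  apply: (@le_trans _ _ (eps / K * `|x| ^+ 4 * K)).
    by apply: ler_pM => //; [rewrite sumr_ge0 // => i _;
      rewrite sumr_ge0|rewrite lerDl].
  by rewrite mulrAC divfK // gt_eqF.
have LD (y z : E3) : ((y + z) *m M) 0 l = (y *m M) 0 l + (z *m M) 0 l by rewrite
  mulmxDl mxE.
have LB (y z : E3) : ((y - z) *m M) 0 l = (y *m M) 0 l - (z *m M) 0 l.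
  by rewrite mulmxBl mxE [X in _ + X = _]mxE.
rewrite (sum5 (fun d => taylor_term d f x)) !LB !LD e1 taylor_term2_mul
  taylor_term3_mul taylor_term4_mul.
rewrite /jet4 [taylor_term 0 f x]/=; ring.
Qed.
End Jet.

(** * Circles through the origin *)

Section Circle.
Variable R : realType.
Local Notation E3 := 'rV[R]_3.
Implicit Types (c n x p : E3).

Definition circle c n (r : R) : set E3 :=
  [set x | dot (x - c) n = 0 /\ dot (x - c) (x - c) = r ^+ 2].

Lemma dotBl x c n : dot (x - c) n = dot x n - dot c n.
Proof. by rewrite /dot -sumrB; apply: eq_bigr => i _; rewrite !mxE mulrBl. Qed.

Lemma dotC x c : dot x c = dot c x.
Proof. by apply: eq_bigr => i _; rewrite mulrC. Qed.

Lemma dot_sqrB x c : dot (x - c) (x - c) = dot x x - 2 * dot x c + dot c c.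
Proof. by rewrite dotBl !(dotC _ (x - c)) !dotBl (dotC c x); ring. Qed.

Lemma dot0l x : dot 0 x = 0.
Proof. by apply: big1 => i _; rewrite mxE mul0r. Qed.

Lemma dotE x c : dot x c = dotp (x 0) (c 0).
Proof. by []. Qed.

Lemma dot_eq0 x : (dot x x == 0) = (x == 0).
Proof.
apply/eqP/eqP => [|->]; last by rewrite dot0l.
rewrite dotE => /dotp_eq0 h; apply/rowP => i; by rewrite h mxE.
Qed.

Lemma dot_ge0 x : 0 <= dot x x.
Proof. by apply: sumr_ge0 => i _; rewrite -expr2 sqr_ge0. Qed.

Lemma circle0P c n r : circle c n r 0 -> forall x,
  circle c n r x <-> (dot x n = 0 /\ dot x x = 2 * dot x c).
Proof.
rewrite /circle /= !sub0r => -[h1 h2] x.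
have cn : dot c n = 0.
  by apply: oppr_inj; rewrite oppr0 -h1 -[in RHS]sub0r dotBl dot0l sub0r.
have cc : dot c c = r ^+ 2.
  by rewrite -h2 -[- c]sub0r dot_sqrB !dot0l; ring.
rewrite dotBl cn subr0 dot_sqrB cc; split => -[e1 e2]; split => //; lra.
Qed.

Lemma circle_center_normal c n r : circle c n r 0 -> dot c n = 0.
Proof. by move=> [/eqP + _]; rewrite /= dotBl dot0l sub0r oppr_eq0 => /eqP. Qed.

Lemma circle_center_neq0 c n r : 0 < r -> circle c n r 0 -> c != 0.
Proof.
move=> r0 [_]; apply: contraPneq => -> /=; rewrite subr0 dot0l => /esym/eqP.
by rewrite expf_eq0 /= gt_eqF.
Qed.

Lemma dotZl a x y : dot (a *: x) y = a * dot x y.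
Proof. by rewrite /dot mulr_sumr; apply: eq_bigr => i _; rewrite mxE mulrA. Qed.

Definition cross c n : E3 := \row_i (if i == o0 then c 0 o1 * n 0 o2 - c 0 o2 * n 0 o1
  else if i == o1 then c 0 o2 * n 0 o0 - c 0 o0 * n 0 o2
  else c 0 o0 * n 0 o1 - c 0 o1 * n 0 o0).

Lemma dot_crossl c n : dot (cross c n) c = 0.
Proof. by rewrite dotE dotp3 !mxE /=; ring. Qed.

Lemma dot_crossr c n : dot (cross c n) n = 0.
Proof. by rewrite dotE dotp3 !mxE /=; ring. Qed.

Lemma cross_neq0 c n : c != 0 -> n != 0 -> dot c n = 0 -> cross c n != 0.
Proof.
move=> c0 n0 cn; rewrite -dot_eq0.
have -> : dot (cross c n) (cross c n) = dot c c * dot n n - dot c n ^+ 2.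
  by rewrite !dotE !dotp3 !mxE /=; ring.
by rewrite cn expr0n subr0 mulf_neq0 // dot_eq0.
Qed.

Lemma dot_cross_collinear c n x : n != 0 -> c != 0 -> dot c n = 0 ->
  dot x c = 0 -> dot x n = 0 -> exists t, x = t *: cross c n.
Proof.
move=> n0 c0 cn xc xn; set w := cross c n.
have ww0 : dotp (w 0) (w 0) != 0 by rewrite -dotE dot_eq0 cross_neq0.
exists (dotp (w 0) (x 0) / dotp (w 0) (w 0)); apply/rowP => l; rewrite mxE.
apply: wedge_eq0P => //; apply: wedge3_eq0.
- transitivity (c 0 o2 * dot x n - n 0 o2 * dot x c); last by rewrite xn xc; ring.
  by rewrite !dotE !dotp3 /wedge !mxE /=; ring.
- transitivity (n 0 o1 * dot x c - c 0 o1 * dot x n); last by rewrite xn xc; ring.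
  by rewrite !dotE !dotp3 /wedge !mxE /=; ring.
- transitivity (c 0 o0 * dot x n - n 0 o0 * dot x c); last by rewrite xn xc; ring.
  by rewrite !dotE !dotp3 /wedge !mxE /=; ring.
Qed.

(** Inversion in the unit sphere turns the circle into the line directed by [v]
    through [(2 * dot c c)^-1 *: c], which is the point of that line closest to the
    origin. The factor [dot v v] makes the curve homogeneous in [v]. *)
Definition circle_bend v c : E3 := (dot v v / (2 * dot c c)) *: c.

Lemma dot_circle_bendr v c (y : E3) :
  dotp (y 0) (circle_bend v c 0) = dot v v / (2 * dot c c) * dot y c.
Proof.
by rewrite /dotp /dot mulr_sumr; apply: eq_bigr => i _; rewrite /circle_bend mxE /dot;
  ring.
Qed.

Lemma dot_bend v c : c != 0 ->
  dot v v / (4 * dot c c) * dotp (v 0) (v 0) =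
  dotp (circle_bend v c 0) (circle_bend v c 0).
Proof.
rewrite -dot_eq0 => c0; rewrite dot_circle_bendr.
have -> : dot (circle_bend v c) c = dot v v / (2 * dot c c) * dot c c by rewrite dotC
  -dot_circle_bendr.
by rewrite -dotE; field.
Qed.

Lemma circle_curve c n r v s : circle c n r 0 -> c != 0 -> v != 0 ->
  dot v n = 0 -> dot v c = 0 ->
  circle c n r (curve (v 0) (circle_bend v c 0) (dot v v / (4 * dot c c)) s).
Proof.
move=> C0 c0 v0 vn vc; apply/(circle0P C0).
have cn := circle_center_normal C0.
have cc0 : dot c c != 0 by rewrite dot_eq0.
have vv0 : dot v v != 0 by rewrite dot_eq0.
set be := _ / (4 * _); set x := curve _ _ _ _.
pose D := 1 + be * s ^+ 2.
have be0 : 0 <= be.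
  by rewrite /be divr_ge0 ?dot_ge0 // mulr_ge0 ?dot_ge0.
have D0 : D != 0 by rewrite gt_eqF // ltr_wpDr // mulr_ge0 // sqr_ge0.
have xE : x = (s / D) *: (v + (s * (dot v v / (2 * dot c c))) *: c).
  by apply/rowP => i; rewrite !mxE /comb /circle_bend !mxE /D; ring.
have dotx y : dot x y = (s / D) * (dot v y + s * (dot v v / (2 * dot c c)) * dot c y).
  rewrite xE /dot !mulr_sumr -big_split /= mulr_sumr; apply: eq_bigr => i _.
  by rewrite !mxE; ring.
split; first by rewrite dotx vn cn; ring.
have -> : dot x x = (s / D) * (dot x v + s * (dot v v / (2 * dot c c)) * dot x c).
  by rewrite dotx (dotC v) (dotC c).
rewrite !dotx vc (dotC c v) vc !mulr0 addr0 add0r /D /be; field.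
have -> : 4%:R * dot c c + dot v v * s ^+ 2 = 4 * dot c c * D.
  by rewrite /D /be; field.
by rewrite cc0 !mulf_neq0 // pnatr_eq0.
Qed.

(** Differentiate the equations of the plane and of the sphere along a curve in
    the circle. *)
Lemma tangent_line_perp c n r x : circle c n r 0 ->
  tangent_line (circle c n r) 0 x -> dot x n = 0 /\ dot x c = 0.
Proof.
move=> C0 [v [g [g0 gC dg]] <-]; rewrite add0r.
have dgi i : is_derive (0 : R) (1 : R) (fun t => g t 0 i) (v 0 i).
  have D : derivable g 0 1 by exact: ex_derive.
  apply: DeriveDef; first by move/derivable_mxP: D.
  by have := derive_mx D; rewrite derive_val => ->; rewrite mxE.
have dlin y : is_derive (0 : R) (1 : R) (fun t => dot (g t) y) (dot v y).
  have -> : (fun t => dot (g t) y) = \sum_i (y 0 i \*: (fun t => g t 0 i)).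
    by apply: funext => t; rewrite fct_sumE; apply: eq_bigr => i _; rewrite /= mulrC.
  have -> : dot v y = \sum_i y 0 i *: v 0 i.
    by apply: eq_bigr => i _; rewrite mulrC.
  apply: (@is_derive_sum _ _ _ 3 (fun i => y 0 i \*: (fun t => g t 0 i)) 0 1
    (fun i => y 0 i *: v 0 i)) => i.
have dsq : is_derive (0 : R) (1 : R) (fun t => dot (g t) (g t)) 0.
  have dgg i : is_derive (0 : R) (1 : R) ((fun t => g t 0 i) * (fun t => g t 0 i))
     (g 0 0 i *: v 0 i + g 0 0 i *: v 0 i) by exact: is_deriveM.
  have := is_derive_sum dgg; rewrite [X in is_derive _ _ _ X]big1 => [|i _];
    last by rewrite g0 mxE !scale0r addr0.
  rewrite (_ : \sum_i _ = (fun t => dot (g t) (g t))) //.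
  by apply: funext => t; rewrite fct_sumE.
have hC : \forall t \near (0 : R), dot (g t) n = 0 /\ dot (g t) (g t) = 2 * dot (g t) c.
  by apply: filterS gC => t /(circle0P C0).
split.
  apply: etrans (esym (@derive_val _ _ _ _ _ _ _ (dlin n))) _.
  rewrite (@near_eq_derive _ _ _ _ (cst 0)) ?derive_cst //.
  by apply: filterS hC => t [].
have : 2 *: dot v c = 0.
  have d2 : is_derive (0 : R) (1 : R) (2 \*: (fun t => dot (g t) c)) (2 *: dot v c).
    exact: is_deriveZ.
  apply: etrans (esym (@derive_val _ _ _ _ _ _ _ d2)) _.
  apply: etrans _ (@derive_val _ _ _ _ _ _ _ dsq).
  apply: near_eq_derive; by apply: filterS hC => t [_ ->].
by move/eqP; rewrite scaler_eq0 pnatr_eq0 => /eqP.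
Qed.
End Circle.

(** * A rectifiable bundle has a second common point *)

Section Forward.
Variable R : realType.
Local Notation E3 := 'rV[R]_3.

(** The normalized map sends the circle into the line through the origin directed
    by the image under [M] of the direction of [L]. *)
Lemma rectified_circle_jet (U : set E3) (f : E3 -> E3) (M : 'M[R]_3) q k t
    (c n : E3) r (L : set E3) (v : E3) :
  U 0 -> open U -> M \in unitmx -> (forall eps, 0 < eps ->
    \forall x \near (0 : E3), forall l,
      `|((f x - f 0) *m M) 0 l - jet4 idfun q k t (x 0) l| <= eps * `|x| ^+ 4) ->
  circle c n r 0 -> 0 < r -> is_line L -> f @` (circle c n r `&` U) `<=` L ->
  v != 0 -> dot v n = 0 -> dot v c = 0 ->
  circle_jet q k t (v 0) (circle_bend v c 0).
Proof.
move=> U0 oU uM hM C0 r0 [a [d [d0 ->]]] fL v0 vn vc.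
have c0 := circle_center_neq0 r0 C0.
apply: (@curve_jet _ q k t (fun x => (f x - f 0) *m M) hM (v 0) (circle_bend v c 0)
   (dot v v / (4 * dot c c)) ((d *m M) 0)).
- by rewrite divr_ge0 ?dot_ge0 // mulr_ge0 ?dot_ge0.
- by rewrite -dotE dot_eq0.
- by rewrite dot_circle_bendr vc mulr0.
- exact: dot_bend.
- apply/existsP; apply: contraNT d0; rewrite negb_exists => /forallP d0.
  rewrite -[d](mulmxK uM) (_ : d *m M = 0) ?mul0mx //.
  by apply/rowP => i; have := d0 i; rewrite negbK => /eqP ->; rewrite mxE.
- have : \forall x \near (0 : E3), U x by exact: open_nbhs_nbhs.
  apply: filterS => x Ux s xE i j.
  have Cx : circle c n r x by rewrite xE; apply: circle_curve.
  have [s1 _ e1] := fL _ (ex_intro2 _ _ x (conj Cx Ux) erefl).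
  have [s0 _ e0] := fL _ (ex_intro2 _ _ 0 (conj C0 U0) erefl).
  have -> : (f x - f 0) *m M = (s1 - s0) *: (d *m M).
    by rewrite -e1 -e0 opprD addrACA subrr add0r -scalerBl -scalemxAl.
  rewrite (_ : ((s1 - s0) *: (d *m M)) 0 = fun l => (s1 - s0) * (d *m M) 0 l).
    exact: wedge_collinear.
  by apply: funext => l; rewrite mxE.
Qed.

(** The point is [(dot P P)^-1 *: P], where [P] has the property that, for the
    centre [c] and the normal [n] of any circle of the bundle, [dot P n = 0] and
    [2 * dot P c = 1]. *)
Lemma rectifiable_common_point (B : set (set E3)) :
  (forall C, B C -> is_circle C) -> is_bundle 0 B ->
  (exists2 S, generic54 S & S `<=` tangent_lines 0 B) ->
  rectifiable_about 0 B -> exists q : E3, q != 0 /\ forall C, B C -> C q.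
Proof.
move=> circB B0 [S genS SB] [U [f [U0 dif rect]]].
have [oU _ _ _] := dif.
have [M [q [k [t [uM hM]]]]] := diffeo_jet U0 dif.
have jet C c n r v : B C -> C = circle c n r -> 0 < r -> v != 0 -> dot v n = 0 ->
    dot v c = 0 -> circle_jet q k t (v 0) (circle_bend v c 0).
  move=> BC CE r0 v0 vn vc; have [L lL fL] := rect _ BC.
  have C0 := B0 _ BC; rewrite CE in C0 fL.
  exact: (rectified_circle_jet U0 oU uM hM C0 r0 lL fL).
pose good (v : 'I_3 -> R) := exists L (x : E3), [/\ S L, L x & v = x 0].
have good_generic d (P : mpoly.mpoly 3 R) : (d < 9)%N ->
    P \is mpoly.ishomog1 d mpoly.mdeg ->
    (forall v, good v -> mpoly.meval v P = 0) -> P = 0.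
  move=> d9 hP vP; apply: (generic54_form_eq0 genS d9 hP) => L x SL Lx.
  by apply: vP; exists L, x.
have good_jet v : good v -> dotp v v != 0 -> exists b, circle_jet q k t v b.
  move=> [L [x [SL Lx ->]]] x0; have [C BC CL] := SB _ SL; subst L.
  have [c [n [r [n0 r0 CE]]]] := circB _ BC.
  have C0 : circle c n r 0 by have := B0 _ BC; rewrite CE.
  have [xn xc] : dot x n = 0 /\ dot x c = 0.
    by apply: (tangent_line_perp C0); rewrite CE in Lx.
  exists (circle_bend x c 0); apply: (jet C c n r) => //.
  by rewrite -dot_eq0.
have [p hp] := circle_jet_center good_generic good_jet.
pose P : E3 := \row_i p i.
have pC C c n r : B C -> C = circle c n r -> n != 0 -> 0 < r ->
    dot P n = 0 /\ 2 * dot P c = 1.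
  move=> BC CE n0 r0; have C0 : circle c n r 0 by rewrite -CE; exact: B0.
  have cn := circle_center_normal C0; have c0 := circle_center_neq0 r0 C0.
  pose v := cross c n; have v0 : v != 0 by exact: cross_neq0.
  have vn : dot v n = 0 by exact: dot_crossr.
  have vc : dot v c = 0 by exact: dot_crossl.
  have vv0 : dotp (v 0) (v 0) != 0 by rewrite -dotE dot_eq0.
  have [h1 h2 _ _] := jet C c n r v BC CE r0 v0 vn vc.
  have bE := hp _ _ vv0 h1 h2.
  have dotP y : dot v y = 0 -> dot P y = dot c y / (2 * dot c c).
    move=> vy; apply: (mulfI vv0).
    transitivity (\sum_i (dotp (v 0) (v 0) * p i - dotp (v 0) p * v 0 i) * y 0 i).
      transitivity (dotp (v 0) (v 0) * dot P y - dotp (v 0) p * dot v y).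
        by rewrite vy mulr0 subr0.
      by rewrite /dot !mulr_sumr -sumrB; apply: eq_bigr => i _; rewrite mxE; ring.
    transitivity (dotp (circle_bend v c 0) (y 0)).
      by apply: eq_bigr => i _; rewrite bE.
    by rewrite dotpC dot_circle_bendr dotC -dotE; ring.
  rewrite !dotP // cn; split; first by rewrite mul0r.
  by field; rewrite dot_eq0.
(* [P = 0] is impossible for a circle, so that the bundle is empty then. *)
have [P0|P0] := eqVneq P 0.
  exists (const_mx 1); split.
    by apply/eqP => /rowP /(_ 0) /eqP; rewrite !mxE oner_eq0.
  move=> C BC; have [c [n [r [n0 r0 CE]]]] := circB _ BC.
  have [_ /eqP] := pC _ _ _ _ BC CE n0 r0.
  by rewrite P0 dot0l mulr0 eq_sym oner_eq0.
have PP0 : dot P P != 0 by rewrite dot_eq0.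
exists ((dot P P)^-1 *: P); split; first by rewrite scaler_eq0 invr_eq0 negb_or PP0.
move=> C BC; have [c [n [r [n0 r0 CE']]]] := circB _ BC.
have CE : C = circle c n r := CE'.
have [Pn Pc] := pC _ _ _ _ BC CE n0 r0.
have C0 : circle c n r 0 by rewrite -CE; exact: B0.
rewrite CE; apply/(circle0P C0); split; first by rewrite dotZl Pn mulr0.
by rewrite dotZl dotC dotZl mulVf // mulr1 dotZl mulrCA Pc mulr1.
Qed.
End Forward.

(** * Smoothness of rational maps *)

Lemma near_eq_differentiable (R : numFieldType) (V W : normedModType R)
    (f g : V -> W) (x : V) :
  (\forall y \near x, f y = g y) -> differentiable f x -> differentiable g x.
Proof.
move=> fg df; have fgx : f x = g x by exact: nbhs_singleton fg.
have H : g \o shift x = cst (g x) + 'd f x +o_ 0 id.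
  apply/eqaddoP => eps eps0.
  have /eqaddoP/(_ _ eps0) := diff_locally df.
  move: fg; rewrite (near_shift 0 x) subr0; apply: filterS2 => h /= e.
  by rewrite /GRing.add /= /GRing.opp /= e fgx.
have dE := diff_unique (diff_continuous df) H.
apply/diff_locallyP; rewrite dE; split => //; exact: diff_continuous.
Qed.

Section Rational.
Variables (R : realType) (n : nat) (U : set 'rV[R]_n).
Hypothesis oU : open U.
Local Notation E := 'rV[R]_n.

(** Closed under directional derivatives by [rational_derive], hence made of
    functions that are smooth on [U]. *)
Inductive rational_on : (E -> R) -> Prop :=
| rational_cst c : rational_on (fun=> c)
| rational_coord i : rational_on (fun x => x 0 i)
| rational_add f g : rational_on f -> rational_on g -> rational_on (fun x => f x + g x)
| rational_mul f g : rational_on f -> rational_on g -> rational_on (fun x => f x * g x)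
| rational_inv f : (forall x, U x -> f x != 0) -> rational_on f ->
    rational_on (fun x => (f x)^-1).

Lemma rational_differentiable f : rational_on f -> forall x, U x -> differentiable f x.
Proof.
elim=> {f} [c|i|f g _ df _ dg|f g _ df _ dg|f f0 _ df] x Ux.
- exact: differentiable_cst.
- exact: differentiable_coord.
- by apply: differentiableD; [exact: df|exact: dg].
- by apply: differentiableM; [exact: df|exact: dg].
- by apply: differentiableV; [exact: df|exact: f0].
Qed.

Lemma rational_derive f v : rational_on f ->
  exists2 g, rational_on g & forall x, U x -> 'D_v f x = g x.
Proof.
have drv f' x : rational_on f' -> U x -> derivable f' x v.
  by move=> rf Ux; apply/diff_derivable/rational_differentiable.
elim=> {f} [c|i|f g rf [f' rf' fE] rg [g' rg' gE]|f g rf [f' rf' fE] rg [g' rg' gE]|f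
  f0 rf [f' rf' fE]].
- by exists (fun=> 0); [exact: rational_cst|move=> x _; rewrite derive_cst].
- exists (fun=> v 0 i); first exact: rational_cst.
  move=> x _; have := derive_mx (@derivable_id _ E x v); rewrite derive_id.
  by move/rowP/(_ i); rewrite mxE => ->.
- exists (fun x => f' x + g' x); first exact: rational_add.
  by move=> x Ux; rewrite -fE // -gE // -deriveD //; apply: drv.
- exists (fun x => f x * g' x + g x * f' x).
    by apply: rational_add; apply: rational_mul.
  by move=> x Ux; rewrite -fE // -gE //;
    exact: (deriveM (drv f x rf Ux) (drv g x rg Ux)).
- exists (fun x => (-1) * ((f x)^-1 * (f x)^-1) * f' x).
    by do !apply: rational_mul => //;
      [exact: rational_cst|exact: rational_inv|exact: rational_inv].
  move=> x Ux; rewrite -fE //.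
  have := deriveV (f0 x Ux) (drv f x rf Ux) => /= e; apply: etrans e _.
  by rewrite -[_ *: _]/(_ * _) expr2 invfM mulN1r.
Qed.

Lemma row_differentiable m (h : 'I_m -> E -> R) x :
  (forall l, differentiable (h l) x) ->
  differentiable (fun y => \row_l h l y : 'rV[R]_m) x.
Proof.
move=> dh; rewrite (_ : (fun _ => _) = \sum_l (fun y => h l y *: (delta_mx 0 l :
  'rV[R]_m))).
  by apply: differentiable_sum => l; apply: differentiableZl.
apply: funext => y; rewrite fct_sumE [LHS]row_sum_delta.
by apply: eq_bigr => l _; rewrite mxE.
Qed.

Definition rational_map m (f : E -> 'rV[R]_m) := forall l,
  exists2 h, rational_on h & forall x, U x -> f x 0 l = h x.

Lemma near_open (P : E -> Prop) x : (forall y, U y -> P y) -> U x ->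
  \forall y \near x, P y.
Proof. by move=> UP Ux; apply: filterS UP _; exact: open_nbhs_nbhs. Qed.

Lemma rational_map_differentiable m (f : E -> 'rV[R]_m) : rational_map f ->
  forall x, U x -> differentiable f x.
Proof.
move=> rf x Ux.
pose h l := sval (cid2 (rf l)).
have hr l : rational_on (h l) by rewrite /h; case: cid2.
have hE l y : U y -> f y 0 l = h l y by rewrite /h; case: cid2 => ? ? /= + Uy; apply.
apply: (@near_eq_differentiable _ _ _ (fun y => \row_l h l y)).
  by apply: near_open => // y Uy; apply/rowP => l; rewrite mxE hE.
by apply: row_differentiable => l; apply: rational_differentiable.
Qed.

Lemma rational_map_derive m (f : E -> 'rV[R]_m) v : rational_map f ->
  rational_map (fun x => 'D_v f x).
Proof.
move=> rf l; have [h rh hE] := rf l; have [g rg gE] := rational_derive v rh.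
exists g => // x Ux; rewrite -gE //.
rewrite derive_mx; last exact/diff_derivable/rational_map_differentiable.
rewrite mxE; apply: near_eq_derive; exact: near_open.
Qed.

Lemma rational_map_smooth m (f : E -> 'rV[R]_m) : rational_map f -> smooth_on U f.
Proof.
move=> + k; elim: k f => [|k IH] f rf /=.
  by move=> x Ux; apply/differentiable_continuous/rational_map_differentiable.
split; first exact: rational_map_differentiable.
by move=> v; apply/IH/rational_map_derive.
Qed.
End Rational.

(** * Inversions, and bundles with a second common point *)

Lemma open_neq_point (R : realType) (V : normedModType R) (a : V) :
  open [set x | x != a].
Proof.
rewrite (_ : [set x | x != a] = ~` [set a]); last by apply/seteqP; split => x /= /eqP.
exact/closed_openC/accessible_closed_set1/hausdorff_accessible/norm_hausdorff.
Qed.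

Section Inversion.
Variable R : realType.
Local Notation E3 := 'rV[R]_3.

(** Inversion in the unit sphere centred at [a], followed by the translation that
    sends [a] to [b]; exchanging [a] and [b] gives the inverse map. *)
Definition inversion (a b x : E3) : E3 := b + (dot (x - a) (x - a))^-1 *: (x - a).

Lemma inversionK a b x : x != a -> inversion b a (inversion a b x) = x.
Proof.
rewrite -subr_eq0 => xa; have d0 : dot (x - a) (x - a) != 0 by rewrite dot_eq0.
rewrite /inversion [b + _]addrC addrK; set d := dot (x - a) (x - a).
have -> : dot (d^-1 *: (x - a)) (d^-1 *: (x - a)) = d^-1.
  transitivity (d^-1 * d^-1 * d); last by rewrite mulfVK.
  by rewrite /d /dot mulr_sumr; apply: eq_bigr => i _; rewrite !mxE; ring.
by rewrite scalerA invrK mulfV // scale1r addrC subrK.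
Qed.

Lemma inversion_neq a b x : x != a -> inversion a b x != b.
Proof.
rewrite -subr_eq0 => xa; rewrite /inversion -subr_eq0 [b + _]addrC addrK.
by rewrite scaler_eq0 invr_eq0 dot_eq0 orbb.
Qed.

Lemma inversion_image a b : inversion a b @` [set x | x != a] = [set x | x != b].
Proof.
apply/seteqP; split => [_ [x /= xa <-]|x /= xb]; first exact: inversion_neq.
by exists (inversion b a x); [exact: inversion_neq|exact: inversionK].
Qed.

Lemma inversion_smooth a b : smooth_on [set x | x != a] (inversion a b).
Proof.
apply: rational_map_smooth; first exact: open_neq_point.
set U := [set x | x != a] => l.
have rsub i : rational_on U (fun x : E3 => (x - a) 0 i).
  rewrite (_ : (fun _ => _) = fun x : E3 => x 0 i + (- a 0 i)).
    by apply: rational_add; [exact: rational_coord|exact: rational_cst].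
  by apply: funext => x; rewrite !mxE.
exists (fun x : E3 => b 0 l + (dot (x - a) (x - a))^-1 * (x - a) 0 l).
  apply: rational_add; first exact: rational_cst.
  apply: rational_mul => //; apply: rational_inv.
    by move=> x /=; rewrite dot_eq0 subr_eq0.
  rewrite (_ : (fun _ => _) = fun x : E3 => (x - a) 0 o0 * (x - a) 0 o0 +
     (x - a) 0 o1 * (x - a) 0 o1 + (x - a) 0 o2 * (x - a) 0 o2).
    by do !apply: rational_add; apply: rational_mul.
  by apply: funext => x; rewrite dotE dotp3.
by move=> x _; rewrite !mxE.
Qed.

Lemma inversion_diffeo a b : diffeo_onto_image [set x | x != a] (inversion a b).
Proof.
split; first exact: open_neq_point.
- by rewrite inversion_image; exact: open_neq_point.
- exact: inversion_smooth.
- exists (inversion b a); first by move=> x; exact: inversionK.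
  by rewrite inversion_image; exact: inversion_smooth.
Qed.

Lemma circle_shift (q c n : E3) r x : circle c n r x <-> circle (c - q) n r (x - q).
Proof. by rewrite /circle /= opprB addrA subrK. Qed.

(** For d = x - q and the centre c' seen from q, the circle is given by
    d.n = 0 and d.d = 2 d.c'; dividing by d.d, the inverse point y = d / (d.d)
    satisfies the linear equations y.n = 0 and 2 y.c' = 1. *)
Lemma inversion_circle_line (q c n : E3) (r : R) : n != 0 -> 0 < r -> circle c n r q ->
  exists2 L, is_line L &
    inversion q 0 @` (circle c n r `&` [set x | x != q]) `<=` L.
Proof.
move=> n0 r0 Cq; have C0 : circle (c - q) n r 0 by rewrite -(subrr q) -circle_shift.
set c' := c - q in C0 *.
have c'n : dot c' n = 0 by exact: circle_center_normal C0.
have c'0 : c' != 0 by exact: circle_center_neq0 r0 C0.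
have cc0 : dot c' c' != 0 by rewrite dot_eq0.
exists [set (2 * dot c' c')^-1 *: c' + t *: cross c' n | t in [set: R]].
  by exists ((2 * dot c' c')^-1 *: c'), (cross c' n); split => //; exact: cross_neq0.
move=> _ [x [Cx /= xq] <-]; rewrite /inversion add0r.
have [dn dd] := (circle0P C0 _).1 ((circle_shift q _ _ _ _).1 Cx).
move: xq; rewrite -subr_eq0; set d := x - q in dn dd * => d0.
have dd0 : dot d d != 0 by rewrite dot_eq0.
set y := (dot d d)^-1 *: d - (2 * dot c' c')^-1 *: c'.
have yc : dot y c' = 0.
  rewrite dotBl !dotZl dd; have dc : dot d c' != 0.
    by apply: contraNneq dd0 => e; rewrite dd e mulr0.
  by field; rewrite dc cc0.
have yn : dot y n = 0 by rewrite dotBl !dotZl dn c'n !mulr0 subrr.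
have [t yt] := dot_cross_collinear n0 c'0 c'n yc yn.
by exists t => //; rewrite -yt addrC subrK.
Qed.

Lemma common_point_rectifiable (B : set (set E3)) (q : E3) :
  (forall C, B C -> is_circle C) -> q != 0 -> (forall C, B C -> C q) ->
  rectifiable_about 0 B.
Proof.
move=> circB q0 Bq; exists [set x | x != q], (inversion q 0); split.
- by rewrite /= eq_sym.
- exact: inversion_diffeo.
- move=> C BC; have [c [n [r [n0 r0 CE]]]] := circB _ BC.
  have := Bq _ BC; rewrite CE; exact: inversion_circle_line.
Qed.
End Inversion.

(** * The theorem *)

Theorem theorem1p1 (R : realType) (B : set (set 'rV[R]_3))
    (circlesB : forall C, B C -> is_circle C)
    (simpleB : simple_bundle 0 B)
    (genericB : exists2 S, generic54 S & S `<=` tangent_lines 0 B) :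
  rectifiable_about 0 B <->
  exists q : 'rV[R]_3, q != 0 /\ forall C, B C -> C q.
Proof.
have [B0 _] := simpleB; split.
  exact: rectifiable_common_point circlesB B0 genericB.
by move=> [q [q0 Bq]]; exact: common_point_rectifiable circlesB q0 Bq.
Qed.
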